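(* For every odd integer $d\geq 3$, there exists an infinite family $\mathfrak{L}$ of $d$-dimensional lens spaces that are mutually eigenvalue equivalent and such that $$\sup_{L_1,L_2\in\mathfrak{L}} \frac{\mathrm{vol}(L_1)}{\mathrm{vol}(L_2)}=\infty.$$
   Context: $S^{2n-1}$ is the unit sphere in $\mathbb{R}^{2n}$ with its metric of constant sectional curvature one. For $q\in\mathbb{N}$ and $s=(s_1,\dots,s_n)\in\mathbb{Z}^n$ with $\gcd(q,s_i)=1$ for all $i$, the lens space $L(q;s)=L(q;s_1,\dots,s_n)$ is the Riemannian manifold $S^{2n-1}/\Gamma_{q;s}$, where $\Gamma_{q;s}\subset \mathrm{SO}(2n)$ is the cyclic group generated by the block diagonal matrix with blocks $R(2\pi s_1/q),\dots,R(2\pi s_n/q)$, with $R(\theta)=\begin{pmatrix}\cos\theta&\sin\theta\\-\sin\theta&\cos\theta\end{pmatrix}$. Its volume is $\mathrm{vol}(S^{2n-1})/q$. Lens spaces are considered up to isometry. Two closed Riemannian manifolds are eigenvalue equivalent if they have the same set of eigenvalues of the Laplace-Beltrami operator on functions, multiplicities being ignored. *)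

(* Defs.v *)
From HB Require Import structures.
From mathcomp Require Import all_boot all_order all_algebra.
From mathcomp Require Import all_classical all_reals all_analysis.

Set Implicit Arguments.
Unset Strict Implicit.
Unset Printing Implicit Defensive.

Import Order.TTheory GRing.Theory Num.Theory.
Import numFieldNormedType.Exports.

Local Open Scope classical_set_scope.
Local Open Scope ring_scope.

(** * The round sphere in ['rV[R]_N] *)

Section Sphere.
Variables (R : realType) (N : nat).
Implicit Types (x y v : 'rV[R]_N) (f : 'rV[R]_N -> R).

Definition dot x y : R := (x *m y^T) 0 0.

(* The library norm on ['rV[R]_N] is the sup norm, hence this one. *)
Definition norm2 x : R := Num.sqrt (dot x x).

Definition sphere : set 'rV[R]_N := [set x | norm2 x = 1].

(* The 0-homogeneous extension x |-> f (x / |x|) to the complement of the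
   origin.  A function f is only ever looked at through its restriction to the
   sphere. *)
Definition radial_ext f : 'rV[R]_N -> R := fun x => f ((norm2 x)^-1 *: x).

(* C^oo on the open set U: every iterated directional derivative exists and is
   differentiable at every point of U. *)
Definition smooth_on (U : set 'rV[R]_N) f : Prop :=
  forall (vs : seq 'rV[R]_N) x, U x ->
    differentiable (foldr (fun v g => 'D_v g) f vs) x.

(* f is C^oo on the sphere iff its radial extension is C^oo off the origin. *)
Definition sphere_smooth f : Prop :=
  smooth_on [set x | x != 0] (radial_ext f).

(* Gradient for the induced metric.  The radial extension is constant along
   rays, so its Euclidean gradient at a point of the sphere is already
   tangent. *)
Definition sphere_grad f x : 'rV[R]_N :=
  \row_i 'D_(delta_mx 0 i) (radial_ext f) x.

(* Divergence of a tangent field X, i.e. the trace of v |-> P_x (D_v X) on the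
   tangent space at x, P_x being the tangential projection and P_x D the
   Levi-Civita connection.  Since D_x of the radial extension of X vanishes,
   the full Euclidean trace has no normal contribution. *)
Definition sphere_div (X : 'rV[R]_N -> 'rV[R]_N) x : R :=
  \sum_i 'D_(delta_mx 0 i) (radial_ext (fun y => X y 0 i)) x.

(* Laplace-Beltrami operator, with the sign making it nonnegative. *)
Definition sphere_laplacian f x : R := - sphere_div (sphere_grad f) x.

End Sphere.

Arguments sphere : clear implicits.

(* Riemannian volume of the unit sphere of dimension d >= 1: the integral of
   sqrt (det g) = \prod_(1 <= j < d) sin (theta_j) ^+ j in the spherical
   coordinates (theta_1, ..., theta_(d-1), phi) of ]0, pi[^(d-1) x ]0, 2 pi[,
   written as a product of integrals in the separate variables. *)
Definition sphere_volume (R : realType) (d : nat) : R :=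
  2 * pi *
  \prod_(1 <= j < d) Rintegral (@lebesgue_measure R) `[0, pi] (fun t => sin t ^+ j).

(** * Lens spaces *)

Record lens (n : nat) := Lens {
  lens_q : nat;
  lens_s : 'I_n -> int;
  lens_q_gt0 : (0 < lens_q)%N;
  lens_coprime : forall i, coprimez lens_q%:Z (lens_s i)
}.

Definition rot2 (R : realType) (theta : R) : 'M[R]_2 :=
  \matrix_(i, j) (if i == j then cos theta
                  else if (i < j)%N then sin theta else - sin theta).

(* R^(2n) is ['rV[R]_(dimn n)], in the form produced by [\mxdiag]. *)
Notation dimn n := (\sum_(i < n) 2)%N.

Section Lens.
Variables (R : realType) (n : nat).
Implicit Types (L : lens n) (P Q : set 'rV[R]_(dimn n)).

Definition lens_gen L : 'M[R]_(dimn n) :=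
  \mxdiag_(i < n) rot2 (2 * pi * (lens_s L i)%:~R / (lens_q L)%:R).

Definition lens_group L : set 'M[R]_(dimn n) :=
  [set A | exists k : nat, A = lens_gen L ^+ k \/ A = invmx (lens_gen L ^+ k)].

(* Matrices act on row vectors from the right; as the group is closed under
   transposition, the orbits are those of the left action on columns. *)
Definition lens_proj L (x : 'rV[R]_(dimn n)) : set 'rV[R]_(dimn n) :=
  [set x *m A | A in lens_group L].

Definition lens_points L : set (set 'rV[R]_(dimn n)) :=
  lens_proj L @` sphere R (dimn n).

(* A function on the lens space is represented by u : set 'rV -> R, of which
   only the values on [lens_points L] matter.  The quotient map is a
   Riemannian covering, so smoothness and the Laplace-Beltrami operator of the
   quotient are computed on the lift of u to the sphere. *)
Definition lens_smooth L (u : set 'rV[R]_(dimn n) -> R) : Prop :=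
  sphere_smooth (u \o lens_proj L).

Definition lens_eigenvalues L : set R :=
  [set lambda | exists u : set 'rV[R]_(dimn n) -> R,
    [/\ lens_smooth L u,
        exists2 P, lens_points L P & u P != 0 &
        forall x, sphere R (dimn n) x ->
          sphere_laplacian (u \o lens_proj L) x = lambda * u (lens_proj L x)]].

Definition eigenvalue_equivalent L1 L2 : Prop :=
  lens_eigenvalues L1 = lens_eigenvalues L2.

Definition lens_volume L : R := sphere_volume R (2 * n).-1 / (lens_q L)%:R.

(* Riemannian distance of the quotient: the least spherical distance
   acos <x, y> between representatives. *)
Definition lens_dist P Q : R := inf [set acos (dot x y) | x in P & y in Q].

Definition isometric L1 L2 : Prop :=
  exists phi : set 'rV[R]_(dimn n) -> set 'rV[R]_(dimn n),
    set_bij (lens_points L1) (lens_points L2) phi /\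
    forall P Q, lens_points L1 P -> lens_points L1 Q ->
      lens_dist (phi P) (phi Q) = lens_dist P Q.

Definition isometry_class L : set (lens n) := [set L' | isometric L L'].

End Lens.

(* Main.v *)
Require Import Defs.
From HB Require Import structures.
From mathcomp Require Import all_boot all_order all_algebra.
From mathcomp Require Import all_classical all_reals all_analysis.
From mathcomp Require Import ring lra.

(** Take for the family the lens spaces L(q; 1, .., 1) with q = 2(m + 2).  The
    idea is that the order q being even forces the set of eigenvalues: it puts
    - 1 into the group, so that eigenfunctions lift to even functions on the
    sphere, and the eigenvalues are exactly the numbers k(k + N - 2) with k
    even, N being the dimension of the ambient space ([lens_eigenvaluesE]).  The
    volumes are vol(S)/q, so their quotients are unbounded.

    That every eigenvalue has this form ([sphere_eigenvalue]) is proved without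
    integration.  Let f be an eigenfunction on the sphere for lambda.  The
    maximum principle gives lambda >= 0, hence a root s >= 0 of
    s(s + N - 2) = lambda, and h(x) = |x|^s f(x/|x|) is harmonic off the origin
    and homogeneous of degree s.  Partial derivatives of h are again harmonic
    and lower the degree by one, until the degree is in [-1, 0[.  For a degree t
    with 2 - N < t < 0 a harmonic function vanishes, since t(t + N - 2) < 0
    would be an eigenvalue of the sphere ([max_principle]).  Unless h = 0, the
    descent must therefore stop earlier, and Euler's identity
    t h = sum_i x_i D_i h shows that it can only stop at degree 0.  Hence s is
    a natural number k, and h(- x) = (-1)^k h(x) ([harmonic_degree]).

    Conversely, the real part of (z_1 conj(z_2))^j is a harmonic polynomial of
    degree 2j and is invariant under the scalars of modulus 1, thus descends to
    every member of the family ([herm_pow_harmonic]).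

    The members are pairwise non-isometric because q can be read off the
    distance.  Points at distance at least pi/2 from the class of x are the
    classes of the vectors Hermitian-orthogonal to x, so the points orthogonal
    in this sense to all of those form the image of the circle {e^(it) x}, a
    closed geodesic of length 2 pi/q.  Its largest distance from x is pi/q
    ([fiber_distances_le], [fiber_distances_half]). *)

Set Implicit Arguments.
Unset Strict Implicit.
Unset Printing Implicit Defensive.

Import Order.TTheory GRing.Theory Num.Theory.
Import numFieldNormedType.Exports.

Local Open Scope classical_set_scope.
Local Open Scope ring_scope.

(** * Directional derivatives and smoothness *)

Section Calculus.
Variables (R : realType).
Implicit Types (V W : normedModType R).

(** The differential at a point is defined by a choice among the continuous
    linear approximations; their uniqueness is what makes the choices for f and
    for g agree. *)
Lemma near_eq_differentiable V W (f g : V -> W) (x : V) :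
  (\near x, f x = g x) -> differentiable f x -> differentiable g x.
Proof.
move=> fg df; have dfc := diff_continuous df.
have E : g \o shift x = cst (g x) + 'd f x +o_ 0 id.
  have /eqaddoP fE := diff_locally df.
  apply/eqaddoP => e e0; have {}fE := fE _ e0.
  have fg0 : \forall y \near (0 : V), f (y + x) = g (y + x).
    by rewrite [\forall y \near _, _](near_shift x)/=; near=> y; rewrite /= sub0r addrNK; near: y.
  near=> y; have -> : (g \o shift x - (cst (g x) + 'd f x)) y = 
   (f \o shift x - (cst (f x) + 'd f x)) y.
    rewrite !fctE /= (nbhs_singleton fg) (near fg0 y)//.
  by near: y.
by apply/diff_locallyP; rewrite (diff_unique dfc E).
Unshelve. all: by end_near. Qed.

Lemma derive_comp (V1 V2 W : normedModType R) (g : V1 -> V2) (f : V2 -> W) x v :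
  differentiable g x -> differentiable f (g x) ->
  'D_v (f \o g) x = 'D_('D_v g x) f (g x).
Proof.
move=> dg df; rewrite !deriveE//; last exact: differentiable_comp.
by rewrite diff_comp.
Qed.

Lemma is_derive_comp (V W : normedModType R) (g : R -> V) (f : V -> W) (t : R) w :
  is_derive t 1 g w -> differentiable f (g t) ->
  is_derive t 1 (f \o g) ('D_w f (g t)).
Proof.
move=> [dg <-] df; have dg' : differentiable g t by apply/derivable1_diffP.
apply: DeriveDef; last by rewrite derive_comp.
by apply/derivable1_diffP/differentiable_comp.
Qed.

Lemma is_derive_affine V (p v : V) (t : R) :
  is_derive t 1 (fun s : R => p + s *: v) v.
Proof.
have dv : is_derive t 1 ( *:%R^~ v : R -> V) v.
  apply: DeriveDef; first exact: diff_derivable.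
  by rewrite deriveE// diff_val scale1r.
have -> : (fun s : R => p + s *: v) = cst p + *:%R^~ v by [].
by rewrite -[X in is_derive _ _ _ X](add0r v); apply: is_deriveD.
Qed.

Lemma is_derive_line (V W : normedModType R) (f : V -> W) p v (t : R) :
  differentiable f (p + t *: v) ->
  is_derive t 1 (fun s : R => f (p + s *: v)) ('D_v f (p + t *: v)).
Proof.
by move=> df; apply: (is_derive_comp (is_derive_affine p v t)).
Qed.

Lemma derive_sumE (V W : normedModType R) (f : V -> W) (I : finType) (c : I -> R)
    (e : I -> V) x :
  differentiable f x ->
  'D_(\sum_i c i *: e i) f x = \sum_i c i *: 'D_(e i) f x.
Proof.
move=> df; rewrite deriveE// linear_sum; apply: eq_bigr => i _.
by rewrite linearZ /= deriveE.
Qed.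

End Calculus.

Section Smooth.
Variables (R : realType) (N : nat).
Local Notation V := 'rV[R]_N.
Implicit Types (U : set V) (f g : V -> R).

Lemma smooth_on_differentiable U f x :
  smooth_on U f -> U x -> differentiable f x.
Proof. by move=> sf; exact: (sf [::]). Qed.

Lemma smooth_on_derive U f v : smooth_on U f -> smooth_on U ('D_v f).
Proof. by move=> sf vs x Ux; rewrite -foldr_rcons; exact: sf. Qed.

Lemma foldr_derive_eq U f g : open U -> (forall x, U x -> f x = g x) ->
  forall (vs : seq V) x, U x ->
    foldr (fun v h => 'D_v h) f vs x = foldr (fun v h => 'D_v h) g vs x.
Proof.
move=> oU fg; elim=> [|v vs IH] x Ux /=; first exact: fg.
apply: near_eq_derive.
by apply: filterS (open_nbhs_nbhs (conj oU Ux)) => y; exact: IH.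
Qed.

Lemma smooth_on_eq U f g : open U -> (forall x, U x -> f x = g x) ->
  smooth_on U f -> smooth_on U g.
Proof.
move=> oU fg sf vs x Ux; apply: near_eq_differentiable (sf vs x Ux).
apply: filterS (open_nbhs_nbhs (conj oU Ux)) => y; exact: (foldr_derive_eq oU fg).
Qed.

(** Coinduction: a class of differentiable functions that is stable under
    directional derivatives, up to equality on U, consists of smooth functions.
    This replaces inductions over lists of directions with Leibniz-type
    expansions. *)
Lemma smooth_on_coind U (C : (V -> R) -> Prop) : open U ->
  (forall f, C f -> forall x, U x -> differentiable f x) ->
  (forall f v, C f -> exists2 g, C g & forall x, U x -> 'D_v f x = g x) ->
  forall f, C f -> smooth_on U f.
Proof.
move=> oU Cd CD f Cf vs; elim/last_ind: vs f Cf => [|vs v IH] f Cf x Ux.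
  exact: Cd.
have [g Cg fg] := CD f v Cf; rewrite foldr_rcons.
apply: near_eq_differentiable (IH g Cg x Ux).
apply: filterS (open_nbhs_nbhs (conj oU Ux)) => y Uy.
exact/esym/(foldr_derive_eq oU fg).
Qed.

(** Closing under sums and products at once gives a class to which
    [smooth_on_coind] applies: the derivative of a product is a sum of products,
    and that of f `^ a is a multiple of f `^ (a - 1) times a derivative of f. *)
Inductive smooth_alg U : (V -> R) -> Prop :=
| SmoothBase f of smooth_on U f : smooth_alg U f
| SmoothAdd f g of smooth_alg U f & smooth_alg U g : smooth_alg U (f \+ g)
| SmoothMul f g of smooth_alg U f & smooth_alg U g : smooth_alg U (f \* g)
| SmoothPow f a of smooth_on U f & (forall x, U x -> 0 < f x) :
    smooth_alg U (fun x => f x `^ a).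

Lemma deriveD_fun f g v x : differentiable f x -> differentiable g x ->
  'D_v (f \+ g) x = 'D_v f x + 'D_v g x.
Proof. by move=> df dg; apply: deriveD; exact: diff_derivable. Qed.

Lemma deriveM_fun f g v x : differentiable f x -> differentiable g x ->
  'D_v (f \* g) x = f x * 'D_v g x + g x * 'D_v f x.
Proof. by move=> df dg; apply: deriveM; exact: diff_derivable. Qed.

Lemma differentiable_powR f a x : differentiable f x -> 0 < f x ->
  differentiable (fun y => f y `^ a) x.
Proof.
move=> df f0; apply: (@differentiable_comp _ _ _ _ f (fun y => y `^ a)) => //.
by apply/derivable1_diffP/derivable_powR; rewrite in_itv/= f0.
Qed.

Lemma derive_powR f a v x : differentiable f x -> 0 < f x ->
  'D_v (fun y => f y `^ a) x = a * f x `^ (a - 1) * 'D_v f x.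
Proof.
move=> df f0; rewrite (@derive_comp _ _ _ _ f (fun y => y `^ a))//; last first.
  by apply/derivable1_diffP/derivable_powR; rewrite in_itv/= f0.
have dp : differentiable (fun y : R => y `^ a) (f x).
  by apply/derivable1_diffP/derivable_powR; rewrite in_itv/= f0.
rewrite (deriveE _ dp) -[X in 'd _ _ X]mulr1 [LHS]linearZ/= -(deriveE _ dp).
by have dv := is_derive1_powR a f0; rewrite derive_val [LHS]mulrC.
Qed.

Lemma smooth_on_cst U (a : R) : open U -> smooth_on U (cst a).
Proof.
move=> oU; apply: (@smooth_on_coind U (fun f => exists b, f = cst b)) => //.
- by move=> _ [b ->] x _; exact: differentiable_cst.
- move=> _ v [b ->]; exists (cst 0); first by exists 0.
  by move=> x _; rewrite derive_cst.
- by exists a.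
Qed.

Lemma smooth_alg_smooth U f : open U -> smooth_alg U f -> smooth_on U f.
Proof.
have dalg h : smooth_alg U h -> forall x, U x -> differentiable h x.
  elim=> {f h} [f sf|f g _ df _ dg|f g _ df _ dg|f a sf f0] x Ux.
  - exact: smooth_on_differentiable Ux.
  - by apply: differentiableD; [exact: df|exact: dg].
  - by apply: differentiableM; [exact: df|exact: dg].
  - by apply: differentiable_powR; [exact: smooth_on_differentiable Ux|exact: f0].
move=> oU af; apply: (@smooth_on_coind U (smooth_alg U)) af => // {f} f v.
elim=> {f} [f sf|f g af [f' af' ff'] ag [g' ag' gg']|
  f g af [f' af' ff'] ag [g' ag' gg']|f a sf f0].
- by exists ('D_v f) => //; apply: SmoothBase; exact: smooth_on_derive.
- exists (f' \+ g'); first exact: SmoothAdd.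
  by move=> x Ux; rewrite deriveD_fun ?ff' ?gg'//; exact: dalg.
- exists ((f \* g') \+ (g \* f')).
    by apply: SmoothAdd; apply: SmoothMul.
  by move=> x Ux; rewrite deriveM_fun ?ff' ?gg'//; exact: dalg.
- exists ((cst a \* (fun x => f x `^ (a - 1))) \* 'D_v f).
    apply: SmoothMul; last by apply: SmoothBase; exact: smooth_on_derive.
    by apply: SmoothMul; [apply: SmoothBase; exact: smooth_on_cst|exact: SmoothPow].
  by move=> x Ux; rewrite derive_powR//; [exact: smooth_on_differentiable Ux|exact: f0].
Qed.

End Smooth.

(** * Symmetry of second derivatives *)

Section Schwarz.
Variables (R : realType) (N : nat).
Local Notation V := 'rV[R]_N.
Implicit Types (U : set V) (f g : V -> R).

Lemma mean_value_origin (phi dphi : R -> R) (h : R) : 0 < h ->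
  (forall t : R, 0 <= t <= h -> is_derive t 1 phi (dphi t)) ->
  exists2 t, 0 < t < h & phi h - phi 0 = h * dphi t.
Proof.
move=> h0 dp; have [t tab E] : exists2 t, t \in `]0, h[%R &
    phi h - phi 0 = dphi t * (h - 0).
  apply: MVT => //.
    by move=> t; rewrite in_itv/= => /andP[t0 th]; apply: dp; rewrite !ltW.
  apply: derivable_within_continuous => t; rewrite in_itv/= => /dp.
  by move=> ?; exact: ex_derive.
by exists t; rewrite ?E ?subr0 1?mulrC//; move: tab; rewrite in_itv.
Qed.

(** The mean value theorem, applied in the direction v to the increment of f
    along w and then in the direction w to the derivative along v. *)
Lemma second_difference U f v w x (h : R) : smooth_on U f -> 0 < h ->
  (forall s t : R, 0 <= s <= h -> 0 <= t <= h -> U (x + s *: v + t *: w)) ->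
  exists s t, [/\ 0 <= s <= h, 0 <= t <= h &
    f (x + h *: v + h *: w) - f (x + h *: v) - f (x + h *: w) + f x =
    h ^+ 2 * 'D_w ('D_v f) (x + s *: v + t *: w)].
Proof.
move=> sf h0 Ubox.
have h00 : 0 <= (0 : R) <= h by rewrite lexx ltW.
have hh : 0 <= h <= h by rewrite lexx ltW.
have df y : U y -> differentiable f y by exact: smooth_on_differentiable.
have [s /andP[s0 sh] E1] : exists2 s, 0 < s < h &
   (f (x + h *: w + h *: v) - f (x + h *: v))
   - (f (x + h *: w + 0 *: v) - f (x + 0 *: v)) =
   h * ('D_v f (x + h *: w + s *: v) - 'D_v f (x + s *: v)).
  apply: (@mean_value_origin (fun s => f (x + h *: w + s *: v) - f (x + s *: v))
     (fun s => 'D_v f (x + h *: w + s *: v) - 'D_v f (x + s *: v)) h h0) => s sh.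
  apply: is_deriveB; apply: is_derive_line; apply: df.
    by rewrite addrAC; exact: Ubox.
  by have := Ubox s 0 sh h00; rewrite scale0r addr0.
have {}sh : 0 <= s <= h by rewrite !ltW.
have [t /andP[t0 th] E2] : exists2 t, 0 < t < h &
   'D_v f (x + s *: v + h *: w) - 'D_v f (x + s *: v + 0 *: w) =
   h * 'D_w ('D_v f) (x + s *: v + t *: w).
  apply: (@mean_value_origin (fun t => 'D_v f (x + s *: v + t *: w))
     (fun t => 'D_w ('D_v f) (x + s *: v + t *: w)) h h0) => t th.
  apply: is_derive_line; apply: (@smooth_on_differentiable _ _ U); last exact: Ubox.
  exact: smooth_on_derive.
exists s, t; split=> //; first by rewrite !ltW.
rewrite expr2 -mulrA -E2 scale0r addr0 (addrAC x (s *: v)) -E1.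
rewrite !scale0r !addr0 (addrAC x (h *: w)); ring.
Qed.

(** The second difference is symmetric in v and w, so [second_difference]
    produces equal values of the two mixed derivatives at points arbitrarily
    close to x, and both are continuous at x. *)
Lemma derive_swap U f v w x : open U -> smooth_on U f -> U x ->
  'D_v ('D_w f) x = 'D_w ('D_v f) x.
Proof.
move=> oU sf Ux; apply/eqP; rewrite -subr_eq0 -normr_eq0 -[_ == _]negbK.
apply/negP => ab0; set b := 'D_v ('D_w f) x in ab0; set a := 'D_w ('D_v f) x in ab0.
pose e := `|b - a| / 2.
have e0 : 0 < e by rewrite divr_gt0// lt_neqAle eq_sym ab0 normr_ge0.
have cont g : smooth_on U g -> \forall y \near x, `|g x - g y| < e.
  move=> /smooth_on_differentiable /(_ Ux) /differentiable_continuous.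
  by move=> /cvgrPdist_lt /(_ _ e0).
have Ca : \forall y \near x, `|a - 'D_w ('D_v f) y| < e.
  exact: cont (smooth_on_derive w (smooth_on_derive v sf)).
have Cb : \forall y \near x, `|b - 'D_v ('D_w f) y| < e.
  exact: cont (smooth_on_derive v (smooth_on_derive w sf)).
have CU : \forall y \near x, U y by exact: open_nbhs_nbhs.
have [r r0 Br] : exists2 r : R, 0 < r & forall y, ball x r y ->
    U y /\ `|a - 'D_w ('D_v f) y| < e /\ `|b - 'D_v ('D_w f) y| < e.
  have : nbhs x [set y | U y /\ `|a - 'D_w ('D_v f) y| < e /\ `|b - 'D_v ('D_w f) y| < e].
    exact: (filterI CU (filterI Ca Cb)).
  by move/nbhs_ballP => [r r0 Br]; exists r.
(* The + 1 keeps the denominator positive when v = w = 0. *)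
pose h := r / (2 * (`|v| + `|w| + 1)).
have c0 : 0 < `|v| + `|w| + 1 by rewrite ltr_wpDl// addr_ge0.
have h0 : 0 < h by rewrite divr_gt0// mulr_gt0.
have box s t : 0 <= s <= h -> 0 <= t <= h -> ball x r (x + s *: v + t *: w).
  move=> /andP[s0 sh] /andP[t0 th]; rewrite -ball_normE /ball_/=.
  rewrite -addrA opprD addNKr normrN.
  apply: (@le_lt_trans _ _ (h * (`|v| + `|w| + 1))).
    apply: le_trans (ler_normD _ _) _; rewrite !normrZ !ger0_norm// mulrDr mulrDr.
    rewrite mulr1; apply: ler_wpDr; [exact: ltW|apply: lerD; exact: ler_wpM2r].
  rewrite /h invfM mulrA -mulrA mulVf ?gt_eqF// mulr1.
  by rewrite ltr_pdivrMr// mulr_natr mulr2n ltrDl.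
have [s [t [sh th E1]]] := @second_difference U f v w x h sf h0
  (fun s t sh th => (Br _ (box s t sh th)).1).
have box' s1 t1 : 0 <= s1 <= h -> 0 <= t1 <= h -> ball x r (x + s1 *: w + t1 *: v).
  by move=> sh' th'; rewrite addrAC; exact: box.
have [s' [t' [sh' th' E2]]] := @second_difference U f w v x h sf h0
  (fun s t sh th => (Br _ (box' s t sh th)).1).
have [_ [Da _]] := Br _ (box s t sh th).
have [_ [_ Db]] := Br _ (box' s' t' sh' th').
move: E1; rewrite (addrAC x).
rewrite (_ : forall p q r s : R, p - q - r + s = p - r - q + s); last by move=> *; ring.
rewrite E2 => /(mulfI (lt0r_neq0 (exprn_gt0 2 h0))) E.
move: Db; rewrite E => Db.
move: ab0 @e e0 {Ca Cb Br E2 E cont} Da Db; move: ('D_w ('D_v f) _) a b => p a b _ e e0 Da Db.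
suff : `|b - a| < e + e by rewrite /e -splitr ltxx.
rewrite -(subrKA p); apply: le_lt_trans (ler_normD _ _) _.
by apply: ltrD => //; rewrite distrC.
Qed.
End Schwarz.

(** * The Euclidean Laplacian and homogeneous functions *)

Section DotProduct.
Variables (R : realType) (N : nat).
Local Notation V := 'rV[R]_N.
Implicit Types (U : set V) (f g : V -> R) (x y : V).

Definition punctured : set V := [set x | x != 0].
Definition evec (i : 'I_N) : V := delta_mx 0 i.
Definition laplacian f x : R := \sum_i 'D_(evec i) ('D_(evec i) f) x.

Lemma open_punctured : open punctured.
Proof.
rewrite (_ : punctured = ~` [set 0]).
  exact/closed_openC/accessible_closed_set1/hausdorff_accessible/norm_hausdorff.
by apply/seteqP; split=> x /= /eqP.
Qed.

Lemma dotE x y : dot x y = \sum_i x 0 i * y 0 i.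
Proof. by rewrite /dot mxE; apply: eq_bigr => i _; rewrite mxE. Qed.

Lemma dotC x y : dot x y = dot y x.
Proof. by rewrite !dotE; apply: eq_bigr => i _; rewrite mulrC. Qed.

Lemma dotDl x y z : dot (x + y) z = dot x z + dot y z.
Proof. by rewrite /dot mulmxDl mxE. Qed.

Lemma dotZl a x z : dot (a *: x) z = a * dot x z.
Proof. by rewrite /dot -scalemxAl mxE. Qed.

Lemma dotDr x y z : dot z (x + y) = dot z x + dot z y.
Proof. by rewrite ![dot z _]dotC dotDl. Qed.

Lemma dotZr a x z : dot z (a *: x) = a * dot z x.
Proof. by rewrite ![dot z _]dotC dotZl. Qed.

Lemma dotNl x z : dot (- x) z = - dot x z.
Proof. by rewrite -scaleN1r dotZl mulN1r. Qed.

Lemma dotNr x z : dot z (- x) = - dot z x.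
Proof. by rewrite dotC dotNl dotC. Qed.

Lemma dot0l x : dot 0 x = 0.
Proof. by rewrite -(scale0r 0) dotZl mul0r. Qed.

Lemma dot_ge0 x : 0 <= dot x x.
Proof. by rewrite dotE sumr_ge0// => i _; rewrite -expr2 sqr_ge0. Qed.

Lemma dot_eq0 x : (dot x x == 0) = (x == 0).
Proof.
apply/eqP/eqP => [|->]; last by rewrite dot0l.
rewrite dotE => /psumr_eq0P H; apply/rowP => i; rewrite mxE; apply/eqP.
by rewrite -sqrf_eq0 expr2; apply/eqP/H => // j _; rewrite -expr2 sqr_ge0.
Qed.

Lemma dot_gt0 x : (0 < dot x x) = (x != 0).
Proof. by rewrite lt_neqAle dot_ge0 andbT eq_sym dot_eq0. Qed.

Lemma dot_evec x i : dot x (evec i) = x 0 i.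
Proof. by rewrite /dot trmx_delta -colE mxE. Qed.

Lemma row_sum_evec x : x = \sum_i x 0 i *: evec i.
Proof. exact: row_sum_delta. Qed.

Lemma sphere_dot x : sphere R N x -> dot x x = 1.
Proof.
by rewrite /sphere /norm2 /= => H; rewrite -(sqr_sqrtr (dot_ge0 x)) H expr1n.
Qed.

Lemma dot_sphere x : dot x x = 1 -> sphere R N x.
Proof. by rewrite /sphere /norm2 /= => ->; rewrite sqrtr1. Qed.

End DotProduct.

Section Laplace.
Variables (R : realType) (N : nat).
Local Notation V := 'rV[R]_N.
Implicit Types (U : set V) (f g : V -> R) (x y v : V).
Local Notation U0 := (@punctured R N).
Local Notation D i f := ('D_(evec R i) f).
Let oU0 : open U0 := @open_punctured R N.

Lemma smooth_onD U f g : open U -> smooth_on U f -> smooth_on U g -> smooth_on U (f \+ g).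
Proof. by move=> oU sf sg; apply: smooth_alg_smooth => //; apply: SmoothAdd; exact: SmoothBase. Qed.

Lemma smooth_onM U f g : open U -> smooth_on U f -> smooth_on U g -> smooth_on U (f \* g).
Proof. by move=> oU sf sg; apply: smooth_alg_smooth => //; apply: SmoothMul; exact: SmoothBase. Qed.

Lemma smooth_on_powR U f a : open U -> smooth_on U f -> (forall x, U x -> 0 < f x) ->
  smooth_on U (fun x => f x `^ a).
Proof. by move=> oU sf f0; apply: smooth_alg_smooth => //; exact: SmoothPow. Qed.

Lemma smooth_on_sum U (I : finType) (F : I -> V -> R) : open U ->
  (forall i, smooth_on U (F i)) -> smooth_on U (fun x => \sum_i F i x).
Proof.
move=> oU sF; elim: (index_enum I) => [|i s IH].
  have -> : (fun x => \sum_(i <- [::]) F i x) = cst 0.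
    by apply/funext => x; rewrite big_nil.
  exact: smooth_on_cst.
have -> : (fun x => \sum_(j <- i :: s) F j x) = F i \+ (fun x => \sum_(j <- s) F j x).
  by apply/funext => x; rewrite big_cons.
exact: smooth_onD.
Qed.

Lemma derive_eq_on U f g v x : open U -> U x -> (forall y, U y -> f y = g y) ->
  'D_v f x = 'D_v g x.
Proof. by move=> oU Ux fg; exact: (foldr_derive_eq oU fg [:: v]). Qed.

Lemma laplacian_eq_on U f g x : open U -> U x -> (forall y, U y -> f y = g y) ->
  laplacian f x = laplacian g x.
Proof.
move=> oU Ux fg; apply: eq_bigr => i _.
exact: (foldr_derive_eq oU fg [:: evec R i; evec R i]).
Qed.

(** A named partial application, so that the structure of linear map can be
    attached to it. *)
Definition dotr (a x : V) : R := dot x a.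

Lemma dotr_is_linear a : linear (dotr a).
Proof. by move=> c x y; rewrite /dotr dotDl dotZl. Qed.

HB.instance Definition _ a := GRing.isLinear.Build R V R _ (dotr a) (dotr_is_linear a).

Lemma dotr_continuous a : continuous (dotr a).
Proof.
move=> x; apply: differentiable_continuous.
have -> : dotr a = \sum_i (fun x : V => x 0 i * a 0 i).
  by apply/funext => y; rewrite /dotr dotE fct_sumE.
apply: differentiable_sum => i.
by apply: differentiableM; [exact: differentiable_coord|exact: differentiable_cst].
Qed.

Lemma dotr_differentiable a x : differentiable (dotr a) x.
Proof. by apply: linear_differentiable; exact: dotr_continuous. Qed.

Lemma derive_dotr a v x : 'D_v (dotr a) x = dot v a.
Proof.
by rewrite deriveE; [rewrite diff_lin//; exact: dotr_continuous|exact: dotr_differentiable].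
Qed.

Lemma smooth_on_dotr U a : open U -> smooth_on U (dotr a).
Proof.
move=> oU.
apply: (@smooth_on_coind _ _ U (fun f => f = dotr a \/ exists b, f = cst b)) => //.
- move=> _ [->|[b ->]] x _; [exact: dotr_differentiable|exact: differentiable_cst].
- move=> _ v [->|[b ->]].
    exists (cst (dot v a)); first by right; exists (dot v a).
    by move=> x _; rewrite derive_dotr.
  exists (cst 0); first by right; exists 0.
  by move=> x _; rewrite derive_cst.
- by left.
Qed.

Lemma dotxx_sum : (fun x : V => dot x x) = \sum_(i < N) (dotr (evec R i) \* dotr (evec R i)).
Proof.
by apply/funext => x; rewrite dotE fct_sumE; apply: eq_bigr => i _; rewrite /= /dotr dot_evec.
Qed.

Lemma differentiable_dotxx x : differentiable (fun x : V => dot x x) x.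
Proof.
rewrite dotxx_sum; apply: differentiable_sum => i.
by apply: differentiableM; exact: dotr_differentiable.
Qed.

Lemma derive_dotxx v x : 'D_v (fun x : V => dot x x) x = 2 * dot x v.
Proof.
rewrite dotxx_sum derive_sum; last first.
  by move=> i; apply/diff_derivable/differentiableM; exact: dotr_differentiable.
rewrite dotE mulr_sumr; apply: eq_bigr => i _.
rewrite deriveM_fun; [|exact: dotr_differentiable..].
by rewrite derive_dotr /dotr !dot_evec; ring.
Qed.

Lemma smooth_on_dotxx U : open U -> smooth_on U (fun x : V => dot x x).
Proof.
move=> oU; have -> : (fun x : V => dot x x) =
    (fun x => \sum_(i < N) (dotr (evec R i) \* dotr (evec R i)) x).
  by rewrite dotxx_sum; apply/funext => x; rewrite fct_sumE.
by apply: smooth_on_sum => // i; apply: smooth_onM => //; exact: smooth_on_dotr.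
Qed.

(** The power |x|^a of the Euclidean norm. *)
Definition pnorm (a : R) x : R := dot x x `^ (a / 2).

Lemma pnorm_gt0 a x : x != 0 -> 0 < pnorm a x.
Proof. by move=> x0; rewrite powR_gt0// dot_gt0. Qed.

Lemma pnormD a b x : x != 0 -> pnorm (a + b) x = pnorm a x * pnorm b x.
Proof. by move=> x0; rewrite /pnorm mulrDl powRD// dot_eq0 x0 implybT. Qed.

Lemma pnorm0 x : pnorm 0 x = 1.
Proof. by rewrite /pnorm mul0r powRr0. Qed.

Lemma pnorm2 x : pnorm 2 x = dot x x.
Proof. by rewrite /pnorm divff// powRr1// dot_ge0. Qed.

Lemma pnorm1 x : pnorm 1 x = norm2 x.
Proof. by rewrite /pnorm mul1r powR12_sqrt// dot_ge0. Qed.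

Lemma pnorm_sphere a x : dot x x = 1 -> pnorm a x = 1.
Proof. by rewrite /pnorm => ->; rewrite powR1. Qed.

Lemma pnormZ a r x : 0 < r -> pnorm a (r *: x) = r `^ a * pnorm a x.
Proof.
move=> r0; rewrite /pnorm dotZl dotZr mulrA powRM ?dot_ge0 ?mulr_ge0 ?ltW//.
rewrite -expr2 -powR_mulrn ?ltW// -powRrM; congr (_ `^ _ * _).
by rewrite mulrC divfK.
Qed.

Lemma smooth_on_pnorm a : smooth_on U0 (pnorm a).
Proof.
apply: smooth_on_powR => //; first exact: smooth_on_dotxx.
by move=> x; rewrite /punctured/= dot_gt0.
Qed.

Lemma derive_pnorm a v x : x != 0 -> 'D_v (pnorm a) x = a * dot x v * pnorm (a - 2) x.
Proof.
move=> x0; rewrite derive_powR ?dot_gt0//; last exact: differentiable_dotxx.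
by rewrite derive_dotxx /pnorm mulrBl divff//; field.
Qed.

Definition graddot f g x : R := \sum_i D i f x * D i g x.

Lemma laplacianM f g x : smooth_on U0 f -> smooth_on U0 g -> x != 0 ->
  laplacian (f \* g) x = f x * laplacian g x
    + 2 * graddot f g x + g x * laplacian f x.
Proof.
move=> sf sg x0; rewrite /laplacian /graddot !mulr_sumr -!big_split /=; apply: eq_bigr => i _.
have df h y : smooth_on U0 h -> U0 y -> differentiable h y.
  exact: smooth_on_differentiable.
rewrite (@derive_eq_on U0 _ ((f \* D i g) \+ (g \* D i f)))//; last first.
  by move=> y y0; rewrite deriveM_fun//; exact: df.
have sDf := smooth_on_derive (evec R i) sf; have sDg := smooth_on_derive (evec R i) sg.
rewrite deriveD_fun; [|exact/(df _ x)/x0/smooth_onM..].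
have [dDf dDg dF dG] : [/\ differentiable (D i f) x, differentiable (D i g) x,
    differentiable f x & differentiable g x] by split; exact: (df _ x).
rewrite !deriveM_fun// /=; move: (f x) (g x) (D i f x) (D i g x) (D i (D i f) x) (D i (D i g) x).
by move=> *; ring.
Qed.

Lemma laplacian_cst (k : R) x : laplacian (cst k : V -> R) x = 0.
Proof.
rewrite /laplacian big1// => i _; rewrite (_ : 'D_(evec R i) (cst k) = cst 0) ?derive_cst//.
by apply/funext => y; rewrite derive_cst.
Qed.

Definition homogeneous (t : R) f := forall r x, 0 < r -> x != 0 -> f (r *: x) = r `^ t * f x.

(** Both sides are the derivative at s = 1 of f (s x) = s^t f x. *)
Lemma euler t f x : homogeneous t f -> smooth_on U0 f -> x != 0 -> 'D_x f x = t * f x.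
Proof.
move=> hf sf x0.
have d1 : is_derive (1 : R) 1 (fun s : R => f (0 + s *: x)) ('D_x f x).
  have := @is_derive_line _ _ _ f 0 x 1; rewrite scale1r add0r; apply.
  exact: (smooth_on_differentiable sf x0).
have d2 : is_derive (1 : R) 1 (fun s : R => f (0 + s *: x)) (t * f x).
  apply: (@near_eq_is_derive _ _ _ (f x \*: (fun s : R => s `^ t))).
    near=> s; rewrite /= add0r hf//; first by rewrite [LHS]mulrC.
    by near: s; exact: lt_nbhsr.
  have := is_deriveZ (f x) (is_derive1_powR t (@ltr01 R)).
  by rewrite powR1 mulr1 /GRing.scale/= mulrC.
by case: d1 => _ <-; case: d2.
Unshelve. all: by end_near. Qed.

Lemma euler_sum t f x : homogeneous t f -> smooth_on U0 f -> x != 0 ->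
  \sum_i x 0 i * D i f x = t * f x.
Proof.
move=> hf sf x0; rewrite -(euler hf sf x0) [X in 'D_X _ _]row_sum_evec derive_sumE//.
exact: (smooth_on_differentiable sf x0).
Qed.

(** Differentiate f (r x) = r^t f x, which multiplies the left-hand side by r. *)
Lemma homogeneous_derive t f v : homogeneous t f -> smooth_on U0 f ->
  homogeneous (t - 1) ('D_v f).
Proof.
move=> hf sf r x r0 x0.
have rx0 : r *: x != 0 by rewrite scaler_eq0 gt_eqF.
have df y : y != 0 -> differentiable f y by exact: (smooth_on_differentiable sf).
have : 'D_v (f \o *:%R r) x = 'D_v (cst (r `^ t) \* f) x.
  by apply: (@derive_eq_on U0) => // y y0 /=; rewrite hf.
rewrite derive_comp//; last exact: df.
rewrite deriveM_fun//; [|exact: df].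
rewrite [X in 'D_X f _]deriveE// diff_val derive_cst mulr0 addr0.
rewrite deriveE; last exact: df.
rewrite linearZ/= -deriveE; last exact: df.
rewrite powRB ?(gt_eqF r0) ?implybT// powRr1 ?ltW// => E.
by apply: (mulfI (lt0r_neq0 r0)); rewrite [LHS]E /=; field; rewrite gt_eqF.
Qed.

Lemma laplacian_pnorm a x : x != 0 ->
  laplacian (pnorm a) x = a * (a + N%:R - 2) * pnorm (a - 2) x.
Proof.
move=> x0; have sp b := smooth_on_pnorm b.
have E i : D i (D i (pnorm a)) x =
    a * pnorm (a - 2) x + a * (a - 2) * pnorm (a - 4) x * (x 0 i * x 0 i).
  rewrite (@derive_eq_on U0 _ ((cst a \* dotr (evec R i)) \* pnorm (a - 2)))//; last first.
    by move=> y y0; rewrite derive_pnorm.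
  rewrite deriveM_fun; last 2 first.
  - by apply: differentiableM; [exact: differentiable_cst|exact: dotr_differentiable].
  - exact: (smooth_on_differentiable (sp _) x0).
  rewrite deriveM_fun; [|exact: differentiable_cst|exact: dotr_differentiable].
  rewrite derive_cst derive_dotr derive_pnorm// /= /dotr !dot_evec.
  rewrite (_ : a - 2 - 2 = a - 4); last by ring.
  by rewrite /evec mxE !eqxx /=; ring.
rewrite /laplacian (eq_bigr _ (fun i _ => E i)) big_split/= sumr_const card_ord.
rewrite -mulr_sumr -dotE -pnorm2 -[a - 4]addr0.
rewrite -(_ : a - 2 - 2 = a - 4 + 0); last by ring.
rewrite -[X in _ + X]mulrA -pnormD// subrK -mulr_natr; ring.
Qed.

(** The gradient of |x|^a is radial, so the cross term of the product rule is
    given by Euler's identity. *)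
Lemma laplacian_pnormM a t f x : homogeneous t f -> smooth_on U0 f -> x != 0 ->
  laplacian (pnorm a \* f) x =
    a * (a + N%:R - 2 + 2 * t) * pnorm (a - 2) x * f x + pnorm a x * laplacian f x.
Proof.
move=> hf sf x0; rewrite (laplacianM (smooth_on_pnorm a) sf x0).
have -> : graddot (pnorm a) f x = a * pnorm (a - 2) x * (t * f x).
  rewrite /graddot -(euler_sum hf sf x0) mulr_sumr; apply: eq_bigr => i _.
  by rewrite derive_pnorm// dot_evec; ring.
rewrite laplacian_pnorm//; move: (laplacian f x) => l; ring.
Qed.

Lemma laplacian_derive f v x : smooth_on U0 f -> x != 0 ->
  laplacian ('D_v f) x = 'D_v (laplacian f) x.
Proof.
move=> sf x0; rewrite (_ : laplacian f = \sum_i (D i (D i f))); last first.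
  by apply/funext => y; rewrite fct_sumE.
rewrite derive_sum; last first.
  move=> i; apply/diff_derivable; apply: (@smooth_on_differentiable _ _ U0 _ x _ x0).
  exact: (smooth_on_derive _ (smooth_on_derive _ sf)).
apply: eq_bigr => i _.
transitivity ('D_(evec R i) ('D_v (D i f)) x).
  by apply: (derive_eq_on _ oU0 x0) => y y0; exact: (derive_swap _ _ oU0 sf y0).
exact: (derive_swap _ _ oU0 (smooth_on_derive _ sf) x0).
Qed.

End Laplace.

(** * The maximum principle *)

Section MaxPrinciple.
Variables (R : realType) (N : nat).
Local Notation V := 'rV[R]_N.
Implicit Types (U : set V) (f g : V -> R) (x y v : V).
Local Notation U0 := (@punctured R N).
Local Notation D i f := ('D_(evec R i) f).
Let oU0 : open U0 := @open_punctured R N.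

Lemma line_nbhs U x v : open U -> U x ->
  exists2 h : R, 0 < h & forall s, `|s| < h -> U (x + s *: v).
Proof.
move=> oU Ux.
have cl : {for (0 : R), continuous (fun s : R => x + s *: v)}.
  apply: differentiable_continuous; apply/derivable1_diffP.
  by case: (is_derive_affine x v 0).
have : nbhs (0 : R) [set s | U (x + s *: v)].
  by apply: cl; rewrite scale0r addr0; exact: open_nbhs_nbhs.
move=> /nbhs_ballP[h h0 Bh]; exists h => // s sh; apply: Bh.
by rewrite -ball_normE /ball_/= sub0r normrN.
Qed.

(** If d2 were positive, then dphi, which vanishes at 0, would be positive just
    to the right of 0, and the mean value theorem would give values of phi above
    phi 0. *)
Lemma derive2_at_max (phi dphi : R -> R) (d2 h : R) : 0 < h ->
  (forall s : R, `|s| < h -> is_derive s 1 phi (dphi s)) ->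
  is_derive (0 : R) 1 dphi d2 ->
  (forall s : R, `|s| < h -> phi s <= phi 0) -> d2 <= 0.
Proof.
move=> h0 dphiE d2E phimax; rewrite leNgt; apply/negP => d20.
have hE (s : R) : s \in `](- h), h[%R -> `|s| < h by rewrite in_itv/= ltr_norml.
have h00 : (0 : R) \in `](- h), h[%R by rewrite in_itv/= oppr_lt0 h0.
have dphi0 : dphi 0 = 0.
  have H : is_derive (0 : R) 1 phi 0.
    apply: (@derive1_at_max _ phi (- h) h) => //.
    - by rewrite ltW// gtrN.
    - by move=> s /hE/dphiE[].
    - by move=> s /hE/phimax.
  by have [_ <-] := dphiE 0 (hE _ h00); case: H.
have [dd dE] := d2E.
have lim2 : (fun s : R => s^-1 *: (dphi (s *: 1 + 0) - dphi 0)) @ 0^' --> d2.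
  by rewrite -dE; exact: dd.
have := cvgr_gt _ lim2 _ d20.
move=> [e /= e0 Be].
pose s := Num.min (e / 2) (h / 2).
have s0 : 0 < s by rewrite lt_min !divr_gt0.
have sh : s < h by rewrite gt_min orbC ltr_pdivrMr// mulr_natr mulr2n ltrDl h0.
have se : s < e by rewrite gt_min ltr_pdivrMr// mulr_natr mulr2n ltrDl e0.
have [t /andP[t0 ts] E] : exists2 t, 0 < t < s & phi s - phi 0 = s * dphi t.
  apply: mean_value_origin => // t /andP[t0 ts]; apply: dphiE; rewrite ger0_norm//.
  exact: le_lt_trans ts sh.
have : 0 < dphi t.
  have := Be t; rewrite /= sub0r normrN gtr0_norm// => /(_ (lt_trans ts se)).
  rewrite dphi0 addr0 subr0 => /(_ (lt0r_neq0 t0)).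
  by rewrite /GRing.scale/= mulr1 pmulr_rgt0// invr_gt0.
move=> dt; have : 0 < phi s - phi 0 by rewrite E mulr_gt0.
by rewrite subr_gt0 ltNge phimax// gtr0_norm.
Qed.

Lemma derive2_max U f x v : open U -> smooth_on U f -> U x ->
  (forall y, U y -> f y <= f x) -> 'D_v ('D_v f) x <= 0.
Proof.
move=> oU sf Ux fmax; have [h h0 Uh] := line_nbhs v oU Ux.
apply: (@derive2_at_max (fun s => f (x + s *: v)) (fun s => 'D_v f (x + s *: v)) _ h h0).
- move=> s /Uh Us; apply: is_derive_line; exact: (smooth_on_differentiable sf Us).
- have := @is_derive_line _ _ _ ('D_v f) x v 0; rewrite scale0r addr0; apply.
  exact: (smooth_on_differentiable (smooth_on_derive v sf) Ux).
- by move=> s /Uh/fmax; rewrite scale0r addr0.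
Qed.

Lemma compact_sphere : compact [set x : V | dot x x = 1].
Proof.
apply: bounded_closed_compact.
  exists 1; split => // M M1 x /= x1; apply: le_trans (ltW M1).
  rewrite [leLHS]/Num.norm /= mx_normrE; apply/bigmax_leP; split => // -[i j] _ /=.
  rewrite -(@ler_pXn2r _ 2)// ?nnegrE// expr1n -normrX ger0_norm ?sqr_ge0//.
  rewrite -x1 dotE (bigD1 j)//= (ord1 i) -expr2 lerDl sumr_ge0// => k _.
  by rewrite -expr2 sqr_ge0.
rewrite (_ : [set _ | _] = (fun x : V => dot x x) @^-1` [set 1]); last by [].
apply: closed_comp => [x _|]; last exact/accessible_closed_set1/hausdorff_accessible/norm_hausdorff.
by apply: differentiable_continuous; exact: differentiable_dotxx.
Qed.

Definition normalize x : V := (norm2 x)^-1 *: x.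

Lemma norm2_gt0 x : x != 0 -> 0 < norm2 x.
Proof. by move=> x0; rewrite sqrtr_gt0 dot_gt0. Qed.

Lemma norm2_sqr x : norm2 x ^+ 2 = dot x x.
Proof. by rewrite sqr_sqrtr// dot_ge0. Qed.

Lemma dot_normalize x : x != 0 -> dot (normalize x) (normalize x) = 1.
Proof.
move=> x0; rewrite dotZl dotZr -norm2_sqr; have := norm2_gt0 x0; move: (norm2 x) => r r0.
by field; rewrite gt_eqF.
Qed.

Lemma normalizeK x : x != 0 -> norm2 x *: normalize x = x.
Proof. by move=> x0; rewrite scalerA divff ?scale1r// gt_eqF// norm2_gt0. Qed.

Lemma dot1_neq0 x : dot x x = 1 -> x != 0.
Proof. by move=> x1; rewrite -dot_eq0 x1 oner_eq0. Qed.

Lemma homogeneous_normalize t f x : homogeneous t f -> x != 0 ->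
  f x = pnorm t x * f (normalize x).
Proof.
move=> hf x0; rewrite -{1}(normalizeK x0) hf ?norm2_gt0//; last exact/dot1_neq0/dot_normalize.
by congr (_ * _); rewrite -pnorm1 /pnorm -powRrM mul1r mulrC.
Qed.

Lemma laplacianD f g x : smooth_on U0 f -> smooth_on U0 g -> x != 0 ->
  laplacian (f \+ g) x = laplacian f x + laplacian g x.
Proof.
move=> sf sg x0; rewrite /laplacian -big_split /=; apply: eq_bigr => i _.
transitivity ('D_(evec R i) (D i f \+ D i g) x).
  apply: (derive_eq_on _ oU0 x0) => y y0.
  by rewrite (deriveD_fun _ (smooth_on_differentiable sf y0) (smooth_on_differentiable sg y0)).
apply: deriveD_fun.
  exact: (smooth_on_differentiable (smooth_on_derive _ sf) x0).
exact: (smooth_on_differentiable (smooth_on_derive _ sg) x0).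
Qed.

(** The number mu + t(t + N - 2) is the eigenvalue of the restriction of f to the
    sphere.  If M is the maximum of f on the sphere, attained at z, then
    f - M |x|^t is at most 0, with equality at z; so its Laplacian at z, which is
    - M (mu + t(t + N - 2)), is at most 0.  This is impossible for M > 0. *)
Lemma max_principle_le t mu f : homogeneous t f -> smooth_on U0 f ->
  (forall x, dot x x = 1 -> laplacian f x = - mu * f x) ->
  mu + t * (t + N%:R - 2) < 0 -> forall x, x != 0 -> f x <= 0.
Proof.
move=> hf sf lf neg x x0; rewrite leNgt; apply/negP => fx.
have [] := @EVT_max_rV R N f [set x | dot x x = 1].
- by exists (normalize x); exact: dot_normalize.
- exact: compact_sphere.
- apply: continuous_in_subspaceT => y; rewrite inE/= => /dot1_neq0 y0.
  exact: (differentiable_continuous (smooth_on_differentiable sf y0)).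
move=> z; rewrite inE/= => z1 zmax.
have {}zmax y : dot y y = 1 -> f y <= f z by move=> y1; apply: zmax; rewrite inE.
set M := f z in zmax.
have M0 : 0 < M.
  apply: lt_le_trans (zmax _ (dot_normalize x0)).
  by move: fx; rewrite (homogeneous_normalize hf x0) pmulr_rgt0// pnorm_gt0.
have z0 := dot1_neq0 z1.
(* M |x|^t is the product of |x|^t and a function of degree 0, which allows
   [laplacian_pnormM] to be used for it. *)
pose k : V -> R := cst (- M).
have sk : smooth_on U0 k by exact: smooth_on_cst.
have sp : smooth_on U0 (pnorm t \* k) by exact: smooth_onM oU0 (smooth_on_pnorm t) sk.
have : laplacian (f \+ (pnorm t \* k)) z <= 0.
  rewrite /laplacian; apply: sumr_le0 => i _.
  refine (@derive2_max U0 (f \+ (pnorm t \* k)) z (evec R i) oU0 (smooth_onD oU0 sf sp) z0 _) => y y0 /=.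
  rewrite /k /= (pnorm_sphere _ z1) mul1r /cst -/M addrN mulrN subr_le0.
  by rewrite (homogeneous_normalize hf y0) ler_pM2l ?pnorm_gt0// zmax// dot_normalize.
have hk : homogeneous 0 k by move=> r y _ _; rewrite powRr0 mul1r.
rewrite (laplacianD sf sp z0) (laplacian_pnormM t hk sk z0) !(pnorm_sphere _ z1).
have -> : laplacian k z = 0 by exact: laplacian_cst.
rewrite lf// -/M /k /=; rewrite leNgt => /negP; apply.
rewrite (_ : _ + _ = - (M * (mu + t * (t + N%:R - 2)))); last by rewrite /cst; ring.
by rewrite oppr_gt0 pmulr_rlt0.
Qed.

Lemma max_principle t mu f : homogeneous t f -> smooth_on U0 f ->
  (forall x, dot x x = 1 -> laplacian f x = - mu * f x) ->
  mu + t * (t + N%:R - 2) < 0 -> forall x, x != 0 -> f x = 0.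
Proof.
move=> hf sf lf neg x x0; apply/eqP; rewrite eq_le.
rewrite (max_principle_le hf sf lf neg x0) /=.
pose k : V -> R := cst (-1).
have sk : smooth_on U0 k by exact: smooth_on_cst.
have hk : homogeneous 0 k by move=> r y _ _; rewrite powRr0 mul1r.
have lk y : laplacian k y = 0 by exact: laplacian_cst.
have := @max_principle_le t mu (k \* f) _ (smooth_onM oU0 sk sf) _ neg x x0.
rewrite /= /k mulN1r oppr_le0; apply.
  by move=> r y r0 y0; rewrite /= hf// !mulN1r mulrN.
move=> y y1; have y0 := dot1_neq0 y1; rewrite (laplacianM sk sf y0) lk lf//.
by rewrite /graddot big1 => [|i _]; [rewrite /k /cst /=; ring|rewrite derive_cst mul0r].
Qed.

End MaxPrinciple.

(** * Degrees of homogeneous harmonic functions *)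

Section Classification.
Variables (R : realType) (N : nat).
Local Notation V := 'rV[R]_N.
Implicit Types (f g : V -> R) (x y v : V).
Local Notation U0 := (@punctured R N).
Local Notation D i f := ('D_(evec R i) f).
Let oU0 : open U0 := @open_punctured R N.
Hypothesis N4 : (4 <= N)%N.

Lemma exists_orthogonal x : x != 0 -> exists2 y, y != 0 & dot x y = 0.
Proof.
move=> x0; have [i xi] : exists i, x 0 i != 0.
  by apply/existsP; apply: contraNT x0 => /existsPn H; apply/eqP/rowP => i;
    rewrite mxE; apply/eqP; rewrite -[_ == _]negbK.
have [j ji] : exists j : 'I_N, j != i.
  have N0 : (0 < N)%N by exact: leq_trans N4.
  have N1 : (1 < N)%N by exact: leq_trans N4.
  have [->|] := eqVneq i (Ordinal N0); first by exists (Ordinal N1).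
  by rewrite eq_sym => H; exists (Ordinal N0).
exists (x 0 j *: evec R i - x 0 i *: evec R j); last first.
  by rewrite dotDr dotNr !dotZr !dot_evec mulrC addrN.
apply/eqP => /rowP/(_ j); rewrite /evec !mxE !eqxx (negbTE ji) /= mulr0 mulr1 sub0r.
by move/eqP; rewrite oppr_eq0 (negbTE xi).
Qed.

(** A function with zero gradient is constant along the half circle from x to - x
    through a vector orthogonal to x, which avoids the origin. *)
Lemma gradient0_even f x : smooth_on U0 f ->
  (forall i y, y != 0 -> D i f y = 0) -> x != 0 -> f (- x) = f x.
Proof.
move=> sf D0 x0; have [y y0 xy] := exists_orthogonal x0.
(* The half circle from x at time 0 to - x at time pi. *)
pose g (s : R) : V := cos s *: x + sin s *: y.
have g0 s : g s != 0.
  rewrite -dot_gt0 /g !(dotDl, dotDr, dotZl, dotZr) (dotC y x) xy !mulr0 addr0 add0r.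
  rewrite !mulrA -!expr2.
  have c0 : 0 <= cos s ^+ 2 * dot x x by rewrite mulr_ge0 ?sqr_ge0 ?dot_ge0.
  have s0 : 0 <= sin s ^+ 2 * dot y y by rewrite mulr_ge0 ?sqr_ge0 ?dot_ge0.
  rewrite lt_neqAle addr_ge0// andbT eq_sym paddr_eq0// !mulf_eq0 !dot_eq0.
  rewrite (negbTE x0) (negbTE y0) !orbF !orbb; apply/negP => /andP[/eqP c /eqP d].
  have := cos2Dsin2 s; rewrite c d expr0n addr0 => /eqP.
  by rewrite eq_sym oner_eq0.
have D0v v z : z != 0 -> 'D_v f z = 0.
  move=> z0; rewrite (row_sum_evec v) derive_sumE; last exact: (smooth_on_differentiable sf z0).
  by rewrite big1// => i _; rewrite D0// scaler0.
have dg (s : R) : exists w : V, is_derive s 1 g w.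
  exists ('D_1 g s); apply/derivableP/derivable1_diffP.
  by apply: differentiableD; apply: differentiableZl; apply/derivable1_diffP.
have H (s : R) : is_derive s 1 (f \o g) 0.
  have [w dw] := dg s; rewrite -(D0v w (g s) (g0 s)).
  by apply: is_derive_comp => //; exact: (smooth_on_differentiable sf (g0 s)).
have := is_derive_0_is_cst pi 0 H.
by rewrite /= /g cospi sinpi cos0 sin0 !scale0r !addr0 scale1r scaleN1r.
Qed.

Lemma derive_even f (eps : R) v x : smooth_on U0 f -> 
  (forall y, y != 0 -> f (- y) = eps * f y) -> x != 0 ->
  'D_v f (- x) = - eps * 'D_v f x.
Proof.
move=> sf fe x0; have df y (y0 : y != 0) : differentiable f y.
  exact: (smooth_on_differentiable sf y0).
have nx0 : - x != 0 by rewrite oppr_eq0.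
have : 'D_v (f \o -%R) x = 'D_v (cst eps \* f) x.
  by apply: (derive_eq_on _ oU0 x0) => y y0 /=; rewrite fe.
rewrite derive_comp; [|by []|exact: df].
rewrite deriveM_fun; [|exact: differentiable_cst|exact: df].
rewrite derive_cst mulr0 addr0 /=.
rewrite [X in 'D_X f _](_ : _ = - v); last first.
  by case: (is_deriveNid x v).
rewrite (deriveE _ (df _ nx0)) linearN /= -(deriveE _ (df _ nx0)) => E.
by rewrite mulNr -E opprK.
Qed.

(** Induction on a bound m of the degree.  For t < 0 the maximum principle
    applies.  Otherwise some D_i f is nonzero, and it is harmonic of degree t - 1
    and of the opposite parity; or all of them vanish, and then Euler's identity
    forces t = 0, while f is even by [gradient0_even].  Since t >= 0 before a step
    down, t - 1 >= -1 > 2 - N after it: this is what N >= 4 is for. *)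
Lemma harmonic_degree (m : nat) t f (eps : R) :
  t < m%:R -> 2 - N%:R < t -> homogeneous t f -> smooth_on U0 f ->
  (forall x, x != 0 -> laplacian f x = 0) ->
  (forall x, x != 0 -> f (- x) = eps * f x) ->
  (exists2 x, x != 0 & f x != 0) ->
  exists2 k : nat, t = k%:R & eps = (-1) ^+ k.
Proof.
have N4R : 4 <= N%:R :> R by rewrite ler_nat.
elim: m t f eps => [|m IH] t f eps tm tN hf sf lf fe [x x0 fx].
  have := @max_principle _ _ t 0 f hf sf _ _ x x0 => H.
  move: fx; rewrite H ?eqxx// => [y y1|]; last by rewrite add0r nmulr_rlt0//; lra.
  by rewrite lf ?oppr0 ?mul0r// dot1_neq0.
have [t0|t0] := ltP t 0.
  have := @max_principle _ _ t 0 f hf sf _ _ x x0 => H.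
  move: fx; rewrite H ?eqxx// => [y y1|]; last by rewrite add0r nmulr_rlt0//; lra.
  by rewrite lf ?oppr0 ?mul0r// dot1_neq0.
have [[i [y y0 Dy]]|no] := pselect (exists i, exists2 y, y != 0 & D i f y != 0).
  have [|||||||k tk ek] := IH (t - 1) (D i f) (- eps).
  - by rewrite ltrBlDr natr1.
  - lra.
  - exact: homogeneous_derive.
  - exact: smooth_on_derive.
  - move=> z z0; rewrite (laplacian_derive _ sf z0).
    transitivity ('D_(evec R i) (cst 0 : V -> R) z); last by rewrite derive_cst.
    exact: (derive_eq_on _ oU0 z0).
  - by move=> z z0; exact: (derive_even _ sf fe z0).
  - by exists y.
  exists k.+1; first by rewrite -natr1 -tk subrK.
  by rewrite exprS -ek mulN1r opprK.
have D0 i y : y != 0 -> D i f y = 0.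
  move=> y0; apply/eqP; rewrite -[_ == _]negbK; apply/negP => Dy.
  by apply: no; exists i, y.
exists 0; last first.
  apply: (mulIf fx); rewrite expr0 mul1r -fe//; exact: gradient0_even.
have := euler_sum hf sf x0; rewrite big1 => [/esym/eqP|i _]; last by rewrite D0// mulr0.
by rewrite mulf_eq0 (negbTE fx) orbF => /eqP.
Qed.

End Classification.

(** * Eigenvalues of the sphere *)

Section SphereSpectrum.
Variables (R : realType) (N : nat).
Local Notation V := 'rV[R]_N.
Implicit Types (f g : V -> R) (x y v : V).
Local Notation U0 := (@punctured R N).
Local Notation D i f := ('D_(evec R i) f).
Let oU0 : open U0 := @open_punctured R N.

Lemma radial_extE f x : radial_ext f x = f (normalize x).
Proof. by []. Qed.

Lemma norm2Z r x : 0 < r -> norm2 (r *: x) = r * norm2 x.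
Proof.
move=> r0; rewrite /norm2 dotZl dotZr mulrA -expr2 sqrtrM ?sqr_ge0//.
by rewrite sqrtr_sqr gtr0_norm.
Qed.

Lemma radial_ext_homogeneous f : homogeneous 0 (radial_ext f).
Proof.
move=> r x r0 x0; rewrite powRr0 mul1r /radial_ext norm2Z// scalerA.
by rewrite invfM -mulrA mulrC -mulrA divff ?mulr1// gt_eqF.
Qed.

Lemma radial_ext_sphere f x : dot x x = 1 -> radial_ext f x = f x.
Proof. by move=> x1; rewrite /radial_ext /norm2 x1 sqrtr1 invr1 scale1r. Qed.

(** The derivatives of the radial extension g are homogeneous of degree -1, so the
    radial extension of the gradient is |x| times the gradient of g.  The factor
    |x| contributes sum_i x_i D_i g, which is 0 because g has degree 0. *)
Lemma sphere_laplacianE f x : sphere_smooth f -> dot x x = 1 ->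
  sphere_laplacian f x = - laplacian (radial_ext f) x.
Proof.
move=> sf x1; have x0 := dot1_neq0 x1; set g := radial_ext f.
have hg : homogeneous 0 g := radial_ext_homogeneous f.
have sDg i : smooth_on U0 (D i g) by exact: smooth_on_derive.
rewrite /sphere_laplacian /sphere_div; congr (- _).
transitivity (\sum_i (D i (D i g) x + x 0 i * D i g x)); last first.
  by rewrite big_split /= (euler_sum hg sf x0) mul0r addr0.
apply: eq_bigr => i _.
transitivity (D i (pnorm 1 \* D i g) x).
  apply: (derive_eq_on _ oU0 x0) => y y0.
  rewrite radial_extE /sphere_grad mxE /= -/g.
  rewrite [RHS](_ : _ = pnorm 1 y * D i g y)//.
  rewrite (homogeneous_normalize (homogeneous_derive _ hg sf) y0) sub0r mulrA -pnormD//.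
  by rewrite subrr pnorm0 mul1r.
rewrite (deriveM_fun _ (smooth_on_differentiable (smooth_on_pnorm 1) x0)
   (smooth_on_differentiable (sDg i) x0)).
by rewrite derive_pnorm// dot_evec !(pnorm_sphere _ x1) !mul1r mulr1 [in RHS]mulrC.
Qed.

Lemma homogeneous_laplacian t f : homogeneous t f -> smooth_on U0 f ->
  homogeneous (t - 2) (laplacian f).
Proof.
move=> hf sf r x r0 x0; rewrite /laplacian mulr_sumr; apply: eq_bigr => i _.
have := homogeneous_derive (evec R i) (homogeneous_derive (evec R i) hf sf) (smooth_on_derive _ sf).
by move=> /(_ r x r0 x0) ->; congr (_ `^ _ * _); ring.
Qed.

(** The maximum principle in degree 0 yields lambda >= 0, so that the radial
    extension times a suitable power |x|^s is harmonic; then [harmonic_degree]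
    applies. *)
Lemma sphere_eigenvalue f lambda : (4 <= N)%N -> sphere_smooth f ->
  (forall x, dot x x = 1 -> f (- x) = f x) ->
  (exists2 x, dot x x = 1 & f x != 0) ->
  (forall x, dot x x = 1 -> sphere_laplacian f x = lambda * f x) ->
  exists k : nat, lambda = (2 * k)%:R * ((2 * k)%:R + N%:R - 2).
Proof.
move=> N4 sf fe [z z1 fz] lf; set g := radial_ext f.
have N4R : 4 <= N%:R :> R by rewrite ler_nat.
have z0 := dot1_neq0 z1.
have gz : g z != 0 by rewrite /g radial_ext_sphere.
have hg : homogeneous 0 g := radial_ext_homogeneous f.
have lg x : dot x x = 1 -> laplacian g x = - lambda * g x.
  by move=> x1; rewrite mulNr /g (radial_ext_sphere f x1) -lf// sphere_laplacianE// opprK.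
have lambda0 : 0 <= lambda.
  rewrite leNgt; apply/negP => l0; move/eqP: gz; apply.
  by apply: (max_principle hg sf lg _ z0); rewrite mul0r addr0.
(* The larger root of s^2 + (N - 2) s - lambda. *)
have [s s0 sE] : exists2 s : R, 0 <= s & s * (s + N%:R - 2) = lambda.
  pose b : R := N%:R - 2; have b0 : 0 <= b by rewrite /b; lra.
  have disc : 0 <= b ^+ 2 + 4 * lambda by rewrite addr_ge0 ?sqr_ge0 ?mulr_ge0.
  exists ((Num.sqrt (b ^+ 2 + 4 * lambda) - b) / 2).
    rewrite divr_ge0// subr_ge0 -[leLHS]ger0_norm// -sqrtr_sqr ler_sqrt//.
    by rewrite lerDl mulr_ge0.
  rewrite -addrA -/b.
  have := sqr_sqrtr disc; move: (Num.sqrt _) => q qE.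
  apply: (@mulIf _ 4) => //; rewrite (_ : _ * _ * 4 = q ^+ 2 - b ^+ 2); last by field.
  by rewrite qE; ring.
pose h := pnorm s \* g.
have sh : smooth_on U0 h by exact: (smooth_onM oU0 (smooth_on_pnorm s) sf).
have hh : homogeneous s h.
  by move=> r x r0 x0; rewrite /h /= pnormZ// hg// powRr0 mul1r mulrA.
have lh x : x != 0 -> laplacian h x = 0.
  move=> x0; rewrite /h (laplacian_pnormM s hg sf x0).
  rewrite (homogeneous_normalize (homogeneous_laplacian hg sf) x0) sub0r.
  have x1 := dot_normalize x0.
  rewrite lg// (homogeneous_normalize hg x0) pnorm0 mul1r.
  by rewrite mulr0 addr0 sE pnormD//; ring.
have [||||k kE] := @harmonic_degree R N N4 (Num.truncn s).+1 s h 1 _ _ hh sh lh.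
- by rewrite truncnS_gt.
- lra.
- move=> x x0; rewrite /h /= mul1r /pnorm dotNl dotNr opprK; congr (_ * _).
  have nN : normalize (- x) = - normalize x.
    by rewrite /normalize /norm2 dotNl dotNr opprK scalerN.
  by rewrite /g !radial_extE nN fe// dot_normalize.
- by exists z => //; rewrite /h /= mulf_neq0// gt_eqF// pnorm_gt0.
move=> /esym/eqP; rewrite -signr_odd; case: (boolP (odd k)) => [_|/even_halfK k2 _].
  by rewrite expr1 => /eqP H; exfalso; lra.
by exists k./2; rewrite mul2n k2 -kE sE.
Qed.

Lemma harmonic_sphere_eigenfunction (k : nat) h : smooth_on U0 h ->
  homogeneous k%:R h -> (forall x, x != 0 -> laplacian h x = 0) ->
  sphere_smooth h /\ forall x, dot x x = 1 ->
    sphere_laplacian h x = k%:R * (k%:R + N%:R - 2) * h x.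
Proof.
move=> sh hh lh.
have E y : U0 y -> (pnorm (- k%:R) \* h) y = radial_ext h y.
  move=> y0; rewrite radial_extE /= (homogeneous_normalize hh y0) mulrA -pnormD//.
  by rewrite addNr pnorm0 mul1r.
have sp := smooth_onM oU0 (smooth_on_pnorm (- k%:R)) sh.
have sr : sphere_smooth h by exact: (smooth_on_eq oU0 E sp).
split => // x x1; have x0 := dot1_neq0 x1.
rewrite sphere_laplacianE// -(laplacian_eq_on oU0 x0 E) (laplacian_pnormM _ hh sh x0).
by rewrite lh// !(pnorm_sphere _ x1); ring.
Qed.

End SphereSpectrum.

(** * Harmonic powers *)

Section HarmonicPowers.
Variables (R : realType) (N : nat).
Local Notation V := 'rV[R]_N.
Implicit Types (f g h c d : V -> R) (x y v : V).
Local Notation U0 := (@punctured R N).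
Local Notation D i f := ('D_(evec R i) f).
Let oU0 : open U0 := @open_punctured R N.

Lemma graddotC f g x : graddot f g x = graddot g f x.
Proof. by apply: eq_bigr => i _; rewrite mulrC. Qed.

Lemma graddotD f g h x : smooth_on U0 f -> smooth_on U0 g -> x != 0 ->
  graddot (f \+ g) h x = graddot f h x + graddot g h x.
Proof.
move=> sf sg x0; rewrite /graddot -big_split /=; apply: eq_bigr => i _.
rewrite (deriveD_fun _ (smooth_on_differentiable sf x0) (smooth_on_differentiable sg x0)).
by rewrite mulrDl.
Qed.

Lemma graddotM f g h x : smooth_on U0 f -> smooth_on U0 g -> x != 0 ->
  graddot (f \* g) h x = f x * graddot g h x + g x * graddot f h x.
Proof.
move=> sf sg x0; rewrite /graddot !mulr_sumr -big_split /=; apply: eq_bigr => i _.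
rewrite (deriveM_fun _ (smooth_on_differentiable sf x0) (smooth_on_differentiable sg x0)).
by rewrite mulrDl !mulrA.
Qed.

Lemma graddot_cst (k : R) h x : graddot (cst k) h x = 0.
Proof. by rewrite /graddot big1// => i _; rewrite derive_cst mul0r. Qed.

Lemma graddot_dotr u v x : graddot (dotr u) (dotr v) x = dot u v.
Proof.
rewrite dotE; apply: eq_bigr => i _.
by rewrite !derive_dotr ![dot (evec R i) _]dotC !dot_evec.
Qed.

Lemma laplacian_dotr u x : laplacian (dotr u) x = 0.
Proof.
rewrite /laplacian big1// => i _.
rewrite (_ : 'D_(evec R i) (dotr u) = cst (dot (evec R i) u)) ?derive_cst//.
by apply/funext => y; rewrite derive_dotr.
Qed.

Definition subf f g : V -> R := f \+ (cst (-1) \* g).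

Lemma subfE f g x : subf f g x = f x - g x.
Proof. by rewrite /subf /= mulN1r. Qed.

Lemma smooth_on_subf f g : smooth_on U0 f -> smooth_on U0 g -> smooth_on U0 (subf f g).
Proof.
move=> sf sg; apply: (smooth_onD oU0 sf (smooth_onM oU0 _ sg)); exact: smooth_on_cst.
Qed.

Lemma graddot_subf f g h x : smooth_on U0 f -> smooth_on U0 g -> x != 0 ->
  graddot (subf f g) h x = graddot f h x - graddot g h x.
Proof.
move=> sf sg x0; have sc : smooth_on U0 (cst (-1)) := smooth_on_cst _ oU0.
rewrite (graddotD _ sf (smooth_onM oU0 sc sg) x0) (graddotM _ sc sg x0).
by rewrite graddot_cst mulr0 addr0 mulN1r.
Qed.

Lemma laplacian_subf f g x : smooth_on U0 f -> smooth_on U0 g -> x != 0 ->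
  laplacian (subf f g) x = laplacian f x - laplacian g x.
Proof.
move=> sf sg x0; have sc : smooth_on U0 (cst (-1)) := smooth_on_cst _ oU0.
rewrite (laplacianD sf (smooth_onM oU0 sc sg) x0) (laplacianM sc sg x0).
by rewrite graddot_cst laplacian_cst !mulr0 !addr0 mulN1r.
Qed.

Section Powers.
Variables (c d : V -> R).

(** Real and imaginary parts of (c + i d)^j. *)
Fixpoint cpow (j : nat) : (V -> R) * (V -> R) :=
  if j is i.+1 then
    let: (a, b) := cpow i in
    (subf (a \* c) (b \* d), (a \* d) \+ (b \* c))
  else (cst 1, cst 0).

Lemma cpow_eq j x y : c x = c y -> d x = d y ->
  ((cpow j).1 x = (cpow j).1 y) * ((cpow j).2 x = (cpow j).2 y).
Proof.
move=> cE dE; elim: j => //= j; case: (cpow j) => a b /= [aE bE].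
by rewrite !subfE /= aE bE cE dE.
Qed.

Lemma cpow_scale j r x : c (r *: x) = r ^+ 2 * c x -> d (r *: x) = r ^+ 2 * d x ->
  ((cpow j).1 (r *: x) = r ^+ (2 * j) * (cpow j).1 x) *
  ((cpow j).2 (r *: x) = r ^+ (2 * j) * (cpow j).2 x).
Proof.
move=> cE dE; elim: j => [|j] /=; first by rewrite muln0 expr0 mul1r mulr0.
case: (cpow j) => a b /= [aE bE].
rewrite !subfE /= aE bE cE dE mulnS exprD; move: (r ^+ 2) (r ^+ (2 * j)) => p q.
by split; ring.
Qed.

Lemma cpow_one j x : c x = 1 -> d x = 0 -> ((cpow j).1 x = 1) * ((cpow j).2 x = 0).
Proof.
move=> cE dE; elim: j => //= j; case: (cpow j) => a b /= [aE bE].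
by rewrite !subfE /= aE bE cE dE; split; ring.
Qed.

Hypotheses (sc : smooth_on U0 c) (sd : smooth_on U0 d).
Hypotheses (lc : forall x, x != 0 -> laplacian c x = 0)
           (ld : forall x, x != 0 -> laplacian d x = 0).
Hypotheses (conf : forall x, x != 0 -> graddot c c x = graddot d d x)
           (orth : forall x, x != 0 -> graddot c d x = 0).

Lemma cpow_smooth j : smooth_on U0 (cpow j).1 /\ smooth_on U0 (cpow j).2.
Proof.
elim: j => [|j] /=; first by split; exact: smooth_on_cst.
case: (cpow j) => a b /= [sa sb]; split.
  exact: (smooth_on_subf (smooth_onM oU0 sa sc) (smooth_onM oU0 sb sd)).
exact: (smooth_onD oU0 (smooth_onM oU0 sa sd) (smooth_onM oU0 sb sc)).
Qed.

(** The hypotheses on c and d say that c + i d is harmonic and that the complex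
    bilinear square of its gradient vanishes.  The last two relations say that
    the gradients of (c + i d)^j and c + i d are orthogonal in the same sense;
    they make the cross term in the Laplacian of the next power vanish. *)
Lemma cpow_harmonic j x : x != 0 ->
  [/\ laplacian (cpow j).1 x = 0, laplacian (cpow j).2 x = 0,
      graddot (cpow j).1 c x = graddot (cpow j).2 d x &
      graddot (cpow j).1 d x = - graddot (cpow j).2 c x].
Proof.
move=> x0; elim: j => [|j] /=.
  by rewrite !laplacian_cst !graddot_cst oppr0.
have := cpow_smooth j; case: (cpow j) => a b /= [sa sb] [la lb g1 g2].
have sac := smooth_onM oU0 sa sc; have sbd := smooth_onM oU0 sb sd.
have sad := smooth_onM oU0 sa sd; have sbc := smooth_onM oU0 sb sc.
have dc : graddot d c x = 0 by rewrite graddotC orth.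
rewrite (laplacian_subf sac sbd x0) (laplacianD sad sbc x0).
rewrite (laplacianM sa sc x0) (laplacianM sb sd x0) (laplacianM sa sd x0) (laplacianM sb sc x0).
rewrite !(graddot_subf _ sac sbd x0) !(graddotD _ sad sbc x0).
rewrite !(graddotM _ sa sc x0) !(graddotM _ sb sd x0) !(graddotM _ sa sd x0) !(graddotM _ sb sc x0).
rewrite la lb (lc x0) (ld x0) (conf x0) (orth x0) dc g1 g2.
by split; ring.
Qed.

End Powers.

Section Hermitian.
Variables (a b p q : V).

(** [herm_re] and [herm_im] are the real and imaginary parts of z_1 conj(z_2),
    where z_1 and z_2 are the complex coordinates whose real and imaginary parts
    are the components along a, b and along p, q. *)
Definition herm_re : V -> R := (dotr a \* dotr p) \+ (dotr b \* dotr q).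
Definition herm_im : V -> R := subf (dotr b \* dotr p) (dotr a \* dotr q).

Hypotheses (aa : dot a a = 1) (bb : dot b b = 1) (pp : dot p p = 1) (qq : dot q q = 1).
Hypotheses (ab : dot a b = 0) (ap : dot a p = 0) (aq : dot a q = 0)
  (bp : dot b p = 0) (bq : dot b q = 0) (pq : dot p q = 0).

Let sdot u : smooth_on U0 (dotr u) := smooth_on_dotr u oU0.
Let sdd u v : smooth_on U0 (dotr u \* dotr v) := smooth_onM oU0 (sdot u) (sdot v).

Lemma smooth_herm : smooth_on U0 herm_re /\ smooth_on U0 herm_im.
Proof.
split; first exact: (smooth_onD oU0 (sdd a p) (sdd b q)).
exact: (smooth_on_subf (sdd b p) (sdd a q)).
Qed.

Lemma laplacian_dotrM u v x : x != 0 -> dot u v = 0 -> laplacian (dotr u \* dotr v) x = 0.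
Proof.
move=> x0 uv; rewrite (laplacianM (sdot u) (sdot v) x0) !laplacian_dotr graddot_dotr uv.
by rewrite !mulr0 !addr0.
Qed.

Lemma laplacian_herm x : x != 0 -> laplacian herm_re x = 0 /\ laplacian herm_im x = 0.
Proof.
move=> x0; rewrite /herm_re /herm_im (laplacianD (sdd a p) (sdd b q) x0).
rewrite (laplacian_subf (sdd b p) (sdd a q) x0) !laplacian_dotrM//.
by rewrite addr0 subr0.
Qed.

(** The general formula for products of linear forms, from which all the
    gradient relations between [herm_re] and [herm_im] are read off. *)
Lemma graddot_dotrM u v w z x : x != 0 ->
  graddot (dotr u \* dotr v) (dotr w \* dotr z) x =
  dotr u x * (dotr w x * dot v z + dotr z x * dot v w) +
  dotr v x * (dotr w x * dot u z + dotr z x * dot u w).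
Proof.
move=> x0; rewrite (graddotM _ (sdot u) (sdot v) x0) ![graddot _ (_ \* _) _]graddotC.
rewrite !(graddotM _ (sdot w) (sdot z) x0) !graddot_dotr.
by rewrite (dotC z v) (dotC w v) (dotC z u) (dotC w u).
Qed.

Lemma graddot_herm x : x != 0 ->
  graddot herm_re herm_re x = graddot herm_im herm_im x /\ graddot herm_re herm_im x = 0.
Proof.
have ba : dot b a = 0 by rewrite dotC.
have pa : dot p a = 0 by rewrite dotC.
have qa : dot q a = 0 by rewrite dotC.
have pb : dot p b = 0 by rewrite dotC.
have qb : dot q b = 0 by rewrite dotC.
have qp : dot q p = 0 by rewrite dotC.
move=> x0.
have Gre h : graddot herm_re h x = graddot (dotr a \* dotr p) h x + graddot (dotr b \* dotr q) h x.
  exact: (graddotD _ (sdd a p) (sdd b q) x0).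
have Gim h : graddot herm_im h x = graddot (dotr b \* dotr p) h x - graddot (dotr a \* dotr q) h x.
  exact: (graddot_subf _ (sdd b p) (sdd a q) x0).
have Gre' u v : graddot (dotr u \* dotr v) herm_re x =
   graddot (dotr a \* dotr p) (dotr u \* dotr v) x + graddot (dotr b \* dotr q) (dotr u \* dotr v) x.
  by rewrite graddotC Gre.
have Gim' u v : graddot (dotr u \* dotr v) herm_im x =
   graddot (dotr b \* dotr p) (dotr u \* dotr v) x - graddot (dotr a \* dotr q) (dotr u \* dotr v) x.
  by rewrite graddotC Gim.
rewrite (Gre herm_re) (Gre herm_im) (Gim herm_im) !Gre' !Gim' !graddot_dotrM//.
rewrite aa bb pp qq ab ap aq bp bq pq ba pa qa pb qb qp.
by split; ring.
Qed.

Definition herm_pow j : V -> R := (cpow herm_re herm_im j).1.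

Lemma herm_pow_harmonic j :
  [/\ smooth_on U0 (herm_pow j), homogeneous (2 * j)%:R (herm_pow j),
      (forall x, x != 0 -> laplacian (herm_pow j) x = 0) & herm_pow j (a + p) = 1].
Proof.
have [sc sd] := smooth_herm; split.
- by case: (cpow_smooth sc sd j).
- move=> r x r0 _; rewrite powR_mulrn ?ltW//.
  by rewrite /herm_pow cpow_scale// /herm_re /herm_im ?subfE /= /dotr !dotZl; ring.
- move=> x x0; have := cpow_harmonic sc sd _ _ _ _ j x0; rewrite /herm_pow.
  move=> H; have [] // := H; move=> y y0.
  + by case: (laplacian_herm y0).
  + by case: (laplacian_herm y0).
  + by case: (graddot_herm y0).
  + by case: (graddot_herm y0).
- have pa : dot p a = 0 by rewrite dotC.
  rewrite /herm_pow cpow_one// /herm_re /herm_im ?subfE /= /dotr !dotDl.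
    by rewrite aa pp ap pa aq pq; ring.
  by rewrite ab (dotC p b) bp aq pq; ring.
Qed.

End Hermitian.
End HarmonicPowers.

(** * Simultaneous rotations *)

Section Rotations.
Variables (R : realType) (n : nat).
Local Notation N := (dimn n).
Local Notation V := 'rV[R]_N.
Implicit Types (x y : V) (a b t : R).

Lemma mul_mxdiag (S : pzSemiRingType) (m : nat) (p : 'I_m -> nat)
    (A B : forall i, 'M[S]_(p i)) :
  mxdiag A *m mxdiag B = \mxdiag_i (A i *m B i).
Proof.
rewrite {2}/mxdiag mul_mxdiag_mxblock; apply/eq_mxblock => i j.
by case: eqVneq => [->|_]; rewrite ?conform_mx_id ?mulmx0.
Qed.

Definition quarter2 : 'M[R]_2 := rot2 (pi / 2).
(** The complex structure for which the lens groups below act by scalars. *)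
Definition J : 'M[R]_N := \mxdiag_(i < n) quarter2.
Definition rotmx t : 'M[R]_N := \mxdiag_(i < n) rot2 t.

Lemma quarter2E i j : quarter2 i j = if i == j then 0 else if (i < j)%N then 1 else -1.
Proof. by rewrite mxE cos_pihalf sin_pihalf. Qed.

Lemma rot2E t : rot2 t = (cos t)%:M + (sin t)%:M *m quarter2.
Proof.
rewrite mul_scalar_mx; apply/matrixP => i j; rewrite !mxE cos_pihalf sin_pihalf.
case: eqP => _; rewrite ?mulr0 ?addr0 ?mulr1n// mulr0n add0r.
by case: ifP; rewrite ?mulr1 ?mulrN1.
Qed.

(** That is, exp (t J) = cos t + sin t J. *)
Lemma rotmxE t : rotmx t = (cos t)%:M + sin t *: J.
Proof.
rewrite -mul_scalar_mx /rotmx /J -!(@mxdiagZ R n (fun=> 2)) mul_mxdiag -mxdiagD.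
by apply/eq_mxdiag => i; exact: rot2E.
Qed.

Lemma J_sqr : J *m J = - 1%:M.
Proof.
rewrite mul_mxdiag -(@mxdiagZ R n (fun=> 2)) -mxdiagN; apply/eq_mxdiag => i.
apply/matrixP => j k; rewrite !mxE !big_ord_recl big_ord0 !quarter2E.
by case: j => -[|[|//]] ?; case: k => -[|[|//]] ? /=;
  rewrite ?mulr0n ?mulr1n ?oppr0 ?(mul0r, mulr0, mul1r, mulr1, addr0, add0r).
Qed.

Lemma J_tr : J^T = - J.
Proof.
rewrite tr_mxdiag -mxdiagN; apply/eq_mxdiag => i.
apply/matrixP => j k; rewrite [LHS]mxE [RHS]mxE !quarter2E.
by case: j => -[|[|//]] ?; case: k => -[|[|//]] ? /=; rewrite ?oppr0 ?opprK.
Qed.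

Lemma rotmxD s t : rotmx (s + t) = rotmx s *m rotmx t.
Proof.
rewrite !rotmxE mulmxDl !mulmxDr !mul_scalar_mx !mul_mx_scalar -!scalemxAl -!scalemxAr.
rewrite J_sqr cosD sinD scale_scalar_mx.
rewrite !scalerA scalerN scalemx1 !scalerDl raddfB /=.
rewrite (mulrC (cos t) (sin s)) [X in _ + X]addrC addrACA.
by congr (_ + _); rewrite addrC.
Qed.

Lemma rotmx0 : rotmx 0 = 1%:M.
Proof. by rewrite rotmxE cos0 sin0 scale0r addr0. Qed.

Lemma rotmx_pi : rotmx pi = - 1%:M.
Proof. by rewrite rotmxE cospi sinpi scale0r addr0 raddfN. Qed.

Lemma rotmx_periodic t (k : nat) : rotmx (t + (2 * pi) * k%:R) = rotmx t.
Proof.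
have e : (2 * pi) * k%:R = (pi *+ 2) *+ k :> R by rewrite mulr_natr mulr_natl.
by rewrite !rotmxE e (periodicn (@cosD2pi R)) (periodicn (@sinD2pi R)).
Qed.

Lemma rotmx_unit t : rotmx t \in unitmx.
Proof.
by apply: (@mulmx1_unit _ _ _ (rotmx (- t)) _).1; rewrite -rotmxD addrN rotmx0.
Qed.

Lemma rotmxV t : invmx (rotmx t) = rotmx (- t).
Proof.
by rewrite -[LHS]mulmx1 -rotmx0 -(addrN t) rotmxD mulmxA mulVmx ?mul1mx ?rotmx_unit.
Qed.

Lemma rotmxX t k : rotmx t ^+ k = rotmx (k%:R * t).
Proof.
elim: k => [|k IH]; first by rewrite expr0 mul0r rotmx0.
by rewrite exprS IH -natr1 mulrDl mul1r addrC rotmxD.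
Qed.

Lemma dotJl x y : dot (x *m J) y = - dot x (y *m J).
Proof. by rewrite /dot trmx_mul J_tr mulNmx mulmxN mulmxA [in RHS]mxE opprK. Qed.

Lemma mulJJ x : x *m J *m J = - x.
Proof. by rewrite -mulmxA J_sqr mulmxN mulmx1. Qed.

Lemma dotJJ x y : dot (x *m J) (y *m J) = dot x y.
Proof. by rewrite dotJl mulJJ dotNr opprK. Qed.

Lemma dot_xJ x : dot x (x *m J) = 0.
Proof. by have := dotJl x x; rewrite dotC => H; lra. Qed.

Lemma mul_rotmx x t : x *m rotmx t = cos t *: x + sin t *: (x *m J).
Proof. by rewrite rotmxE mulmxDr mul_mx_scalar -scalemxAr. Qed.

Lemma dot_rotmx x y t : dot x (y *m rotmx t) = cos t * dot x y + sin t * dot x (y *m J).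
Proof. by rewrite (mul_rotmx y t) dotDr !dotZr. Qed.

Lemma dot_rotmx2 x y s t : dot (x *m rotmx s) (y *m rotmx t) = dot x (y *m rotmx (t - s)).
Proof.
rewrite (dot_rotmx x y (t - s)) (mul_rotmx x s) (mul_rotmx y t).
rewrite !(dotDl, dotDr, dotZl, dotZr) dotJJ dotJl.
by rewrite cosB sinB; ring.
Qed.

(** Unit vectors of distinct blocks span orthogonal complex lines. *)
Definition block_vec (i : 'I_n) : V :=
  \mxrow_(k < n) (if k == i then delta_mx 0 0 else 0 : 'rV[R]_2).

Lemma dot_mxrow (F G : 'I_n -> 'rV[R]_2) :
  dot (\mxrow_k F k : V) (\mxrow_k G k) = \sum_k dot (F k) (G k).
Proof. by rewrite /dot tr_mxrow mul_mxrow_mxcol summxE. Qed.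

Lemma dot_block_vec i : dot (block_vec i) (block_vec i) = 1.
Proof.
rewrite dot_mxrow (bigD1 i)//= eqxx big1 => [|k /negbTE->]; last by rewrite dot0l.
by rewrite addr0 -/(evec R 0) dot_evec mxE !eqxx.
Qed.

Lemma dot_block_vec_neq i j t : i != j -> dot (block_vec i) (block_vec j *m rotmx t) = 0.
Proof.
move=> ij; rewrite mul_mxrow_mxdiag dot_mxrow big1// => k _.
have [->|_] := eqVneq k i; last by rewrite dot0l.
by rewrite (negbTE ij) mul0mx dotC dot0l.
Qed.

End Rotations.

(** * The spectrum of the lens spaces in the family *)

Section LensFamily.
Variables (R : realType) (n : nat).
Local Notation N := (dimn n).
Local Notation V := 'rV[R]_N.
Implicit Types (x y z : V) (m k : nat) (P Q Z : set V).
Hypothesis n2 : (2 <= n)%N.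

Lemma scalar_lens_q_gt0 m : (0 < 2 * m.+2)%N. Proof. by []. Qed.

Lemma scalar_lens_coprime m (i : 'I_n) : coprimez (2 * m.+2)%:Z 1.
Proof. by rewrite /coprimez gcdz1. Qed.

(** The order q = 2(m + 2) is even, so that - 1 belongs to the group, and larger
    than 2, so that the group contains a non-real scalar. *)
Definition scalar_lens m : lens n :=
  @Lens n (2 * m.+2) (fun=> 1) (scalar_lens_q_gt0 m) (scalar_lens_coprime m).

Definition angle m : R := pi / m.+2%:R.

Lemma angle_gt0 m : 0 < angle m.
Proof. by rewrite divr_gt0// pi_gt0. Qed.

Lemma angle_mul m : m.+2%:R * angle m = pi.
Proof. by rewrite mulrC divfK// pnatr_eq0. Qed.

Lemma angle_le m : angle m <= pi / 2.
Proof. by rewrite ler_pM2l ?pi_gt0// lef_pV2 ?posrE// ler_nat. Qed.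

Lemma sin_angle_gt0 m : 0 < sin (angle m).
Proof.
apply: sin_gt0_pi; rewrite angle_gt0 /= (le_lt_trans (angle_le m))//.
by rewrite ltr_pdivrMr// mulr_natr mulr2n ltrDl pi_gt0.
Qed.

Lemma lens_genE m : lens_gen R (scalar_lens m) = rotmx n (angle m).
Proof.
rewrite /lens_gen /rotmx; apply/eq_mxdiag => i; congr rot2.
rewrite mulr1 natrM /angle; have : m.+2%:R != 0 :> R by rewrite pnatr_eq0.
by move: (m.+2%:R) => r r0; field.
Qed.

(** Inverses are positive powers, so orbits can be parametrized by natural
    numbers. *)
Lemma rotmx_neg m k : rotmx n (- (k%:R * angle m)) = rotmx n ((k * (2 * m.+2).-1)%:R * angle m).
Proof.
rewrite -(rotmx_periodic _ _ k); congr rotmx.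
rewrite -(angle_mul m) natrM (_ : (2 * m.+2).-1%:R = 2 * m.+2%:R - 1 :> R); first by ring.
by rewrite -natrM -[X in X%:R - 1](@prednK (2 * m.+2))// -natr1 addrK.
Qed.

Lemma lens_projP m x y : lens_proj (scalar_lens m) x y <->
  exists k, y = x *m rotmx n (k%:R * angle m).
Proof.
split => [[_ [k [->|->]] <-]|[k ->]]; rewrite ?lens_genE ?rotmxX.
- by exists k.
- by rewrite rotmxV rotmx_neg; exists (k * (2 * m.+2).-1)%N.
- by exists (lens_gen R (scalar_lens m) ^+ k); [exists k; left|rewrite lens_genE rotmxX].
Qed.

Lemma lens_proj_refl m x : lens_proj (scalar_lens m) x x.
Proof. by apply/lens_projP; exists 0; rewrite mul0r rotmx0 mulmx1. Qed.

Lemma rotmx_natD m j k : rotmx n (j%:R * angle m) *m rotmx n (k%:R * angle m) =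
  rotmx n ((j + k)%:R * angle m).
Proof. by rewrite -rotmxD -mulrDl -natrD. Qed.

Lemma lens_proj_rot m x k : lens_proj (scalar_lens m) (x *m rotmx n (k%:R * angle m)) =
  lens_proj (scalar_lens m) x.
Proof.
apply/seteqP; split => y /lens_projP[j ->]; apply/lens_projP.
  by exists (k + j)%N; rewrite -mulmxA rotmx_natD.
exists (j + k * (2 * m.+2).-1)%N; rewrite -rotmx_natD -rotmx_neg -mulmxA.
congr (x *m _); rewrite -!rotmxD; congr rotmx; ring.
Qed.

Lemma lens_proj_opp m x : lens_proj (scalar_lens m) (- x) = lens_proj (scalar_lens m) x.
Proof.
by rewrite -(lens_proj_rot m x m.+2) angle_mul rotmx_pi mulmxN mulmx1.
Qed.

Lemma dim_ge4 : (4 <= N)%N.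
Proof. by rewrite sum_nat_const card_ord muln2 -[4%N]/(2.*2) leq_double. Qed.

Let i0 : 'I_n := Ordinal (leq_trans (isT : (0 < 2)%N) n2).
Let i1 : 'I_n := Ordinal n2.
Let a := block_vec R i0.
Let p := block_vec R i1.

(** Eigenfunctions are even because - 1 is in the group.  In the other direction
    the function on the quotient evaluates the harmonic power of [herm_pow] at an
    arbitrary representative, which is legitimate by invariance under all the
    rotations. *)
Lemma lens_eigenvaluesE m : lens_eigenvalues (scalar_lens m) =
  [set lambda : R | exists k, lambda = (2 * k)%:R * ((2 * k)%:R + N%:R - 2)].
Proof.
apply/seteqP; split => lambda.
  move=> [u [su [_ [x /sphere_dot x1 <-] ux] eig]].
  apply: (sphere_eigenvalue dim_ge4 su).
  - by move=> y y1 /=; rewrite lens_proj_opp.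
  - by exists x.
  - by move=> y /dot_sphere; exact: eig.
move=> [k ->].
have d0 x y : dot x y = 0 -> dot y x = 0 by rewrite dotC.
have i01 : i0 != i1 by [].
have ap : dot a p = 0 by have := dot_block_vec_neq (0 : R) i01; rewrite rotmx0 mulmx1.
have apJ : dot a (p *m J R n) = 0.
  have := dot_block_vec_neq (pi / 2 : R) i01.
  by rewrite (dot_rotmx _ _ (pi / 2)) cos_pihalf sin_pihalf mul0r add0r mul1r.
have aJp : dot (a *m J R n) p = 0 by rewrite dotJl apJ oppr0.
have aa : dot a a = 1 by exact: dot_block_vec.
have pp : dot p p = 1 by exact: dot_block_vec.
have [sh hh lh h1] := @herm_pow_harmonic R N a (a *m J R n) p (p *m J R n)
  aa (etrans (dotJJ a a) aa) pp (etrans (dotJJ p p) pp)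
  (dot_xJ a) ap apJ aJp (etrans (dotJJ a p) ap) (dot_xJ p) k.
set h := herm_pow _ _ _ _ k in sh hh lh h1.
have hrot x t : h (x *m rotmx n t) = h x.
  have E y : (dot (x *m rotmx n t) y = cos t * dot x y - sin t * dot x (y *m J R n)) *
    (dot (x *m rotmx n t) (y *m J R n) = cos t * dot x (y *m J R n) + sin t * dot x y).
    rewrite (mul_rotmx x t) !(dotDl, dotZl) dotJJ dotJl.
    by split; [rewrite mulrN|].
  have cs := cos2Dsin2 t.
  rewrite /h /herm_pow (fun c d A B => (@cpow_eq R N c d k (x *m rotmx n t) x A B).1)//
    /herm_re /herm_im ?subfE /= /dotr (E a).1 (E a).2 (E p).1 (E p).2.
    move: (dot x a) (dot x (a *m _)) (dot x p) (dot x (p *m _)) => A B C D.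
    rewrite -[RHS]mul1r -cs; ring.
  move: (dot x a) (dot x (a *m _)) (dot x p) (dot x (p *m _)) => A B C D.
  rewrite -[RHS]mul1r -cs; ring.
pose u P : R := h (xget 0 P).
have uE : u \o lens_proj (scalar_lens m) = h.
  apply/funext => x /=; rewrite /u.
  have := @xgetPex _ 0 (lens_proj (scalar_lens m) x) (ex_intro _ x (lens_proj_refl m x)).
  by move=> /lens_projP[j ->]; rewrite hrot.
have [ss lapl] := harmonic_sphere_eigenfunction sh hh lh.
have z0 : a + p != 0.
  by rewrite -dot_eq0 !(dotDl, dotDr) (d0 _ _ ap) ap aa pp; apply/eqP; lra.
exists u; split.
- by rewrite /lens_smooth uE.
- exists (lens_proj (scalar_lens m) (normalize (a + p))).
    by exists (normalize (a + p)) => //; exact/dot_sphere/dot_normalize.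
  rewrite -[u _]/((u \o lens_proj (scalar_lens m)) (normalize (a + p))) uE.
  have := h1; rewrite (homogeneous_normalize hh z0) => H.
  by apply/eqP => H0; move: H; rewrite H0 mulr0 => /eqP; rewrite eq_sym oner_eq0.
- move=> x /sphere_dot x1; rewrite uE lapl//.
  by rewrite -[u _]/((u \o lens_proj (scalar_lens m)) x) uE.
Qed.

End LensFamily.

(** * The order is an isometry invariant *)

Section Isometry.
Variables (R : realType) (n : nat).
Local Notation N := (dimn n).
Local Notation V := 'rV[R]_N.
Implicit Types (x y z : V) (m k : nat) (P Q Z : set V).
Hypothesis n2 : (2 <= n)%N.
Local Notation proj m := (@lens_proj R n (scalar_lens n m)).
Local Notation rot t := (rotmx n t).

Lemma dot_unit_in x y : dot x x = 1 -> dot y y = 1 -> dot x y \in `[(-1), 1].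
Proof.
move=> x1 y1; have := dot_ge0 (x + y); have := dot_ge0 (x - y).
rewrite !(dotDl, dotDr, dotNl, dotNr) x1 y1 (dotC y x) in_itv/= => H1 H2.
by apply/andP; split; lra.
Qed.

Lemma acos_le (a b : R) : a \in `[(-1), 1] -> b \in `[(-1), 1] -> a <= b -> acos b <= acos a.
Proof.
move=> ai bi ab; rewrite leNgt; apply/negP.
have I c : c \in `[(-1), 1] -> acos c \in `[0, pi] :> bool.
  by rewrite !in_itv/= => ci; rewrite acos_ge0// acos_lepi.
rewrite -ltr_cos ?I// !acosK//.
by rewrite ltNge ab.
Qed.

Lemma dot_rot_unit x t : dot (x *m rot t) (x *m rot t) = dot x x.
Proof. by rewrite dot_rotmx2 subrr rotmx0 mulmx1. Qed.

Lemma lens_dist_le m x y k : dot x x = 1 -> dot y y = 1 ->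
  lens_dist (proj m x) (proj m y) <= acos (dot x (y *m rot (k%:R * angle R m))).
Proof.
move=> x1 y1; apply: ge_inf; last first.
  exists x; first exact: lens_proj_refl.
  exists (y *m rot (k%:R * angle R m)) => //.
  by apply/lens_projP; exists k.
exists 0 => _ [_ /lens_projP[i ->]] [_ /lens_projP[j ->]] <-.
by apply: acos_ge0; have := @dot_unit_in (x *m rot (i%:R * angle R m)) (y *m rot (j%:R * angle R m));
  rewrite in_itv/=; apply; rewrite dot_rot_unit.
Qed.

Lemma lens_dist_ge m x y (c : R) : dot x x = 1 -> dot y y = 1 -> c \in `[(-1), 1] ->
  (forall k, dot x (y *m rot (k%:R * angle R m)) <= c) ->
  acos c <= lens_dist (proj m x) (proj m y).
Proof.
move=> x1 y1 ci H; apply: lb_le_inf.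
  by exists (acos (dot x y)), x; [exact: lens_proj_refl|exists y => //; exact: lens_proj_refl].
move=> _ [_ /lens_projP[i ->]] [_ /lens_projP[j ->]] <-.
rewrite dot_rotmx2 addrC rotmxD rotmx_neg rotmx_natD.
by apply: acos_le => //; apply: dot_unit_in; rewrite ?dot_rot_unit.
Qed.

Definition orthJ x y := dot x y = 0 /\ dot x (y *m J R n) = 0.

Lemma zero_in_acos_dom : (0 : R) \in `[(-1), 1]. Proof. by rewrite in_itv/= lerN10 ler01. Qed.

(** A distance at least pi/2 means that all products of representatives are at
    most 0.  They come in opposite pairs since - 1 is in the group, so they all
    vanish; the generator then also gives the product with y J, because the sine
    of its angle is not 0. *)
Lemma lens_dist_orth m x y : dot x x = 1 -> dot y y = 1 ->
  (pi / 2 <= lens_dist (proj m x) (proj m y)) <-> orthJ x y.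
Proof.
move=> x1 y1; split; last first.
  move=> [xy xyJ]; rewrite -acos0; apply: lens_dist_ge => //; first exact: zero_in_acos_dom.
  by move=> k; rewrite dot_rotmx xy xyJ !mulr0 addr0.
move=> far.
have le0 k : dot x (y *m rot (k%:R * angle R m)) <= 0.
  have := le_trans far (lens_dist_le m k x1 y1); rewrite -acos0.
  have xyi : dot x (y *m rot (k%:R * angle R m)) \in `[(-1), 1].
    by apply: dot_unit_in; rewrite ?dot_rot_unit.
  move: (dot x _) xyi => c ci; rewrite !leNgt => /negP ac; apply/negP => c0; apply: ac.
  have I b : b \in `[(-1), 1] -> acos b \in `[0, pi] :> bool.
    by rewrite !in_itv/= => bi; rewrite acos_ge0// acos_lepi.
  by rewrite -ltr_cos ?I ?zero_in_acos_dom// !acosK ?zero_in_acos_dom.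
have eq0 k : dot x (y *m rot (k%:R * angle R m)) = 0.
  apply/eqP; rewrite eq_le le0/=.
  have := le0 (k + m.+2)%N; rewrite -rotmx_natD angle_mul rotmx_pi mulmxN mulmx1 mulmxN dotNr.
  by rewrite oppr_le0.
have xy : dot x y = 0 by have := eq0 0; rewrite mul0r rotmx0 mulmx1.
split => //; have := eq0 1; rewrite mul1r dot_rotmx xy mulr0 add0r => /eqP.
by rewrite mulf_eq0 gt_eqF ?sin_angle_gt0//= => /eqP.
Qed.

(** The component z of y orthogonal to the complex line of x is orthogonal to x,
    hence to y by hypothesis, and so to itself.  Thus y is in the complex line
    of x, and it has norm 1. *)
Lemma orthJ_sub x y : dot x x = 1 -> dot y y = 1 ->
  (forall z, dot z z = 1 -> orthJ x z -> orthJ y z) ->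
  exists2 t, - pi <= t <= pi & y = x *m rot t.
Proof.
move=> x1 y1 sub; set al := dot y x; set be := dot y (x *m J R n).
pose z := y - al *: x - be *: (x *m J R n).
have xJx : dot (x *m J R n) x = 0 by rewrite dotC dot_xJ.
have xJxJ : dot (x *m J R n) (x *m J R n) = 1 by rewrite dotJJ.
have xz : dot x z = 0.
  by rewrite /z !(dotDr, dotNr, dotZr) x1 dot_xJ dotC -/al; ring.
have xJz : dot (x *m J R n) z = 0.
  by rewrite /z !(dotDr, dotNr, dotZr) xJx xJxJ dotC -/be; ring.
have yE : y = al *: x + be *: (x *m J R n).
  apply/eqP; rewrite -subr_eq0 opprD addrA -/z; apply/negPn/negP => z0.
  have [|yz _] := sub (normalize z) (dot_normalize z0).
    split; first by rewrite /normalize dotZr xz mulr0.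
    by rewrite -[LHS]opprK -dotJl /normalize dotZr xJz mulr0 oppr0.
  have {}yz : dot y z = 0.
    by rewrite -(normalizeK z0) dotZr yz mulr0.
  have := dot_gt0 z; rewrite z0 {1}/z !(dotDl, dotNl, dotZl) yz xz xJz.
  by rewrite !mulr0 !subr0 ltxx.
have ab : al ^+ 2 + be ^+ 2 = 1.
  by rewrite -y1 {1 2}yE !(dotDl, dotDr, dotZl, dotZr) x1 xJx xJxJ dot_xJ; ring.
have ali : -1 <= al <= 1.
  by have := dot_unit_in y1 x1; rewrite in_itv.
have ca : cos (acos al) = al by rewrite acosK// in_itv.
have sa : sin (acos al) = `|be|.
  by rewrite sin_acos// -sqrtr_sqr; congr (Num.sqrt _); rewrite -ab; ring.
have a0 := acos_ge0 ali; have api := acos_lepi ali.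
have [b0|b0] := leP 0 be.
  exists (acos al); first by apply/andP; split; lra.
  by rewrite mul_rotmx ca sa ger0_norm.
exists (- acos al); first by apply/andP; split; lra.
by rewrite mul_rotmx cosN sinN ca sa ltr0_norm// opprK.
Qed.

(** Some multiple of the angle is within half a step of - t modulo 2 pi. *)
Lemma cos_nearest m t : - pi <= t <= pi ->
  exists k, cos (angle R m / 2) <= cos (t + k%:R * angle R m).
Proof.
move=> /andP[t1 t2]; have th0 := angle_gt0 R m; have thpi := angle_le R m.
set th := angle R m in th0 thpi *.
(* The integral part of v is the number of steps nearest to 2 pi - t; adding
   2 pi makes it nonnegative. *)
pose v := (2 * pi - t) / th + 1 / 2.
have v0 : 0 <= v.
  have p0 := pi_gt0 R; have num0 : 0 <= 2 * pi - t by lra.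
  have : 0 <= (2 * pi - t) / th by rewrite divr_ge0// ltW.
  by rewrite /v; lra.
have /andP[] := truncn_itv v0; set k := Num.truncn v => k1 k2.
have vE : v * th = 2 * pi - t + th / 2 by rewrite /v; field; rewrite gt_eqF.
have k1' : k%:R * th <= v * th by rewrite ler_pM2r.
have k2' : v * th < (k%:R + 1) * th by rewrite ltr_pM2r// natr1.
exists k; rewrite (_ : t + k%:R * th = (t + k%:R * th - 2 * pi) + pi *+ 2); last first.
  by rewrite -mulr_natl; ring.
rewrite cosD2pi -[leRHS]cos_norm; set w := _ - _.
have pw : `|w| <= th / 2.
  by rewrite ler_norml; apply/andP; split; rewrite /w; lra.
have I : th / 2 \in `[0, pi] by rewrite in_itv/=; apply/andP; split; lra.
have I' : `|w| \in `[0, pi] by rewrite in_itv/= normr_ge0 (le_trans pw)//; lra.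
by rewrite leNgt ltr_cos// -leNgt.
Qed.

(** Halfway between two elements of the group no element is closer than half a
    step: reduce k modulo q, which puts the argument between half a step and
    2 pi minus half a step. *)
Lemma cos_half_step m k : cos ((k%:R + 1 / 2) * angle R m) <= cos (angle R m / 2).
Proof.
have th0 := angle_gt0 R m; have thpi := angle_le R m; have am := angle_mul R m.
set th := angle R m in th0 thpi am *.
have -> : cos ((k%:R + 1 / 2) * th) = cos (((k %% (2 * m.+2))%:R + 1 / 2) * th).
  rewrite {1}(divn_eq k (2 * m.+2)) -[RHS](periodicn (@cosD2pi R) (k %/ (2 * m.+2))).
  have -> : (pi *+ 2) *+ (k %/ (2 * m.+2)) = 2 * pi * (k %/ (2 * m.+2))%:R :> R.
    by rewrite mulr_natr mulr_natl.
  by congr cos; rewrite -am natrD 2!natrM; ring.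
have : (k %% (2 * m.+2) < 2 * m.+2)%N by rewrite ltn_mod.
move: (k %% _)%N => r rq; have {}rq : r%:R + 1 <= 2 * m.+2%:R :> R.
  by rewrite natr1 -natrM ler_nat.
have r0 : 0 <= r%:R :> R by [].
have rth : r%:R * th + th <= 2 * pi.
  by rewrite -am -{2}[th]mul1r -mulrDl mulrA ler_pM2r.
have rth0 : 0 <= r%:R * th by rewrite mulr_ge0// ltW.
have I : th / 2 \in `[0, pi] by rewrite in_itv/=; apply/andP; split; lra.
rewrite mulrDl; have [le_pi|gt_pi] := leP (r%:R * th + 1 / 2 * th) pi.
  have I' : r%:R * th + 1 / 2 * th \in `[0, pi] by rewrite in_itv/=; apply/andP; split; lra.
  by rewrite leNgt ltr_cos// -leNgt; lra.
rewrite -cosN -(cosD2pi (- _)).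
have I' : - (r%:R * th + 1 / 2 * th) + pi *+ 2 \in `[0, pi].
  by rewrite -mulr_natl in_itv/=; apply/andP; split; lra.
by rewrite leNgt ltr_cos// -leNgt -mulr_natl; lra.
Qed.

(** The condition on Q, phrased with the distance only so that isometries preserve
    it, says that Q lies on the image of the circle of all unit multiples of a
    representative of P. *)
Definition fiber_distances (L : lens n) : set R :=
  [set r | exists P Q, [/\ lens_points L P, lens_points L Q, r = lens_dist P Q &
    forall Z, lens_points L Z -> pi / 2 <= lens_dist P Z -> pi / 2 <= lens_dist Q Z]].

Lemma fiber_distances_isometric L1 L2 : isometric R L1 L2 ->
  fiber_distances L1 `<=` fiber_distances L2.
Proof.
move=> [phi [[phifun phiinj phisurj] iso]] r [P [Q [LP LQ -> PQ]]].
exists (phi P), (phi Q); split; [exact: phifun|exact: phifun|by rewrite iso|].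
move=> Z /phisurj[Z0 LZ0 <-]; rewrite !iso//; exact: PQ.
Qed.

Lemma fiber_distances_le m r : fiber_distances (scalar_lens n m) r -> r <= angle R m / 2.
Proof.
move=> [_ [_ [[x /sphere_dot x1 <-] [y /sphere_dot y1 <-] -> H]]].
have th0 := angle_gt0 R m; have thpi := angle_le R m.
have [t tpi yE] : exists2 t, - pi <= t <= pi & y = x *m rot t.
  apply: orthJ_sub => // z z1 /(lens_dist_orth m x1 z1) xz.
  apply/(lens_dist_orth m y1 z1); apply: H => //.
  by exists z => //; exact: dot_sphere.
have [k ck] := cos_nearest m tpi.
apply: le_trans (lens_dist_le m k x1 y1) _.
have I : angle R m / 2 \in `[0, pi] by rewrite in_itv/=; apply/andP; split; lra.
rewrite -[leRHS]cosK//; apply: acos_le; rewrite ?in_itv/= ?cos_geN1 ?cos_le1//.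
  have := @dot_unit_in x (y *m rot (k%:R * angle R m)).
  by rewrite in_itv/=; apply; rewrite ?dot_rot_unit.
by rewrite yE -mulmxA -rotmxD dot_rotmx x1 dot_xJ mulr1 mulr0 addr0.
Qed.

Lemma fiber_distances_half m : fiber_distances (scalar_lens n m) (angle R m / 2).
Proof.
have th0 := angle_gt0 R m; have thpi := angle_le R m.
pose x := block_vec R (Ordinal n2); have x1 : dot x x = 1 by exact: dot_block_vec.
pose y := x *m rot (angle R m / 2).
have y1 : dot y y = 1 by rewrite dot_rot_unit.
exists (proj m x), (proj m y); split.
- by exists x => //; exact: dot_sphere.
- by exists y => //; exact: dot_sphere.
- have I : angle R m / 2 \in `[0, pi] by rewrite in_itv/=; apply/andP; split; lra.
  have E k : dot x (y *m rot (k%:R * angle R m)) = cos ((k%:R + 1 / 2) * angle R m).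
    rewrite /y -mulmxA -rotmxD dot_rotmx x1 dot_xJ mulr1 mulr0 addr0; congr cos.
    by field.
  apply/eqP; rewrite eq_le -[X in (X <= _) && _]cosK// -[X in _ && (_ <= X)]cosK//.
  apply/andP; split.
    apply: lens_dist_ge => //; first by rewrite in_itv/= cos_geN1 cos_le1.
    by move=> k; rewrite E cos_half_step.
  apply: le_trans (lens_dist_le m 0 x1 y1) _; rewrite E add0r.
  by rewrite (_ : 1 / 2 * angle R m = angle R m / 2)//; field.
- move=> _ [z /sphere_dot z1 <-] /(lens_dist_orth m x1 z1)[xz xzJ].
  apply/(lens_dist_orth m y1 z1); rewrite /orthJ /y (mul_rotmx x).
  by rewrite !(dotDl, dotZl) dotJJ dotJl xz xzJ oppr0 !mulr0 addr0.
Qed.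

Lemma isometric_homog_lens m1 m2 : isometric R (scalar_lens n m1) (scalar_lens n m2) ->
  (m2 <= m1)%N.
Proof.
move=> /fiber_distances_isometric/(_ _ (fiber_distances_half m1))/fiber_distances_le.
rewrite ler_pM2r// ler_pM2l ?pi_gt0// lef_pV2 ?posrE ?ltr0n// ler_nat.
by rewrite !ltnS.
Qed.

Lemma isometric_refl (L : lens n) : isometric R L L.
Proof.
by exists id; split => //; split => // P LP; exists P.
Qed.

Lemma isometry_class_inj : injective (fun m => isometry_class R (scalar_lens n m)).
Proof.
move=> m1 m2 /= E; apply/eqP; rewrite eqn_leq.
have H1 : isometry_class R (scalar_lens n m1) (scalar_lens n m2).
  by rewrite E; exact: isometric_refl.
have H2 : isometry_class R (scalar_lens n m2) (scalar_lens n m1).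
  by rewrite -E; exact: isometric_refl.
by rewrite (isometric_homog_lens H1) (isometric_homog_lens H2).
Qed.

End Isometry.

(** * Volumes and conclusion *)

Section Volume.
Variables (R : realType).
Local Notation mu := (@lebesgue_measure R).

(** The integrand is nonnegative and at least cos (pi / 4) ^+ j on the middle half of
    the interval. *)
Lemma Rintegral_sin_gt0 j : 0 < Rintegral mu `[0, pi] (fun t => sin t ^+ j).
Proof.
have p0 := pi_gt0 R.
pose c : R := cos (pi / 4) ^+ j.
have c0 : 0 < c by rewrite exprn_gt0// cos_gt0_pihalf//; apply/andP; split; lra.
have cont (a b : R) : {within `[a, b], continuous (fun t : R => sin t ^+ j)}.
  apply: continuous_subspaceT => t.
  by apply: (@continuous_comp _ _ _ (@sin R) (fun x => x ^+ j)); 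
    [exact: continuous_sin|exact: exprn_continuous].
have int : mu.-integrable `[0, pi] (EFin \o (fun t : R => sin t ^+ j)).
  by apply: continuous_compact_integrable => //; exact: segment_compact.
have sub : (`[pi / 4, 3 * pi / 4] : set R) `<=` `[0, pi].
  by move=> t /=; rewrite !in_itv/= => /andP[a b]; apply/andP; split; lra.
have sin0 (t : R) : t \in `[0, pi] -> 0 <= sin t :> R.
  by rewrite in_itv/= => tp; exact: sin_ge0_pi.
have low (t : R) : t \in `[pi / 4, 3 * pi / 4] -> c <= sin t ^+ j.
  rewrite in_itv/= => /andP[t1 t2]; rewrite lerXn2r ?nnegrE//.
  - by apply: cos_ge0_pihalf; apply/andP; split; lra.
  - by apply: sin0; rewrite in_itv/=; apply/andP; split; lra.
  rewrite -cosBpihalf -[leRHS]cos_norm.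
  have nt : `|t - pi / 2| <= pi / 4 by rewrite ler_norml; apply/andP; split; lra.
  rewrite leNgt ltr_cos// ?in_itv/= -?leNgt//.
  - by apply/andP; split; lra.
  - by rewrite normr_ge0 (le_trans nt)//; lra.
have le1 : ((c * (pi / 2))%:E <= \int[mu]_(t in `[0%R, pi]) (sin t ^+ j)%:E)%E.
  apply: (@le_trans _ _ (\int[mu]_(t in `[(pi / 4)%R, (3 * pi / 4)%R]) (sin t ^+ j)%:E)%E); last first.
    apply: ge0_subset_integral => //; first exact: (measurable_int mu int).
    by move=> t tp; rewrite lee_fin exprn_ge0// sin0.
  apply: (@le_trans _ _ (\int[mu]_(t in `[(pi / 4)%R, (3 * pi / 4)%R]) (cst c%:E t))%E).
    rewrite integral_cst//= lebesgue_measure_itv/= lte_fin.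
    rewrite ifT; last by lra.
    by rewrite EFinM lee_pmul2l// -EFinB lee_fin; lra.
  apply: ge0_le_integral => //.
  - by move=> t _; rewrite lee_fin ltW.
  - by apply: (measurable_funS _ sub (measurable_int mu int)).
rewrite /Rintegral; apply: fine_gt0; apply/andP; split.
  by apply: lt_le_trans le1; rewrite lte_fin mulr_gt0// divr_gt0.
by rewrite ltey_eq integrable_fin_num.
Qed.

Lemma sphere_volume_gt0 d : 0 < sphere_volume R d.
Proof.
rewrite /sphere_volume mulr_gt0 ?mulr_gt0 ?pi_gt0// prodr_gt0// => j _.
exact: Rintegral_sin_gt0.
Qed.

End Volume.

Theorem theorem1p3 (R : realType) (d : nat) (d_odd : odd d) (d_ge3 : (3 <= d)%N) :
  exists F : set (lens d.+1./2),
    [/\ infinite_set (@isometry_class R d.+1./2 @` F),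
        (forall L1 L2, F L1 -> F L2 -> eigenvalue_equivalent R L1 L2) &
        ereal_sup [set (lens_volume R L1 / lens_volume R L2)%:E
                  | L1 in F & L2 in F] = +oo%E].
Proof.
have n2 : (2 <= d.+1./2)%N by exact: (@half_leq 4 d.+1).
exists (range (scalar_lens d.+1./2)); split.
- rewrite (image_comp (scalar_lens d.+1./2)) => fin; apply: infinite_nat.
  have inj : {in [set: nat] &, injective (@isometry_class R d.+1./2 \o scalar_lens d.+1./2)}.
    by move=> m1 m2 _ _; exact: (@isometry_class_inj R _ n2).
  by rewrite -(eq_finite_set (inj_card_eq inj)).
- by move=> _ _ [m1 _ <-] [m2 _ <-]; rewrite /eigenvalue_equivalent !lens_eigenvaluesE.
(* The volumes of the members 0 and m have quotient (m + 2) / 2. *)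
- apply/eq_infty => A; pose m := Num.truncn (2 * A).
  apply: (@le_trans _ _ (lens_volume R (scalar_lens d.+1./2 0)
                       / lens_volume R (scalar_lens d.+1./2 m))%:E).
    have v0 := sphere_volume_gt0 R (2 * d.+1./2).-1.
    have Am : 2 * A < m.+1%:R by exact: truncnS_gt.
    rewrite lee_fin /lens_volume /=; move: (sphere_volume R _) v0 => v v0.
    rewrite (_ : _ / _ = m.+2%:R / 2); first by rewrite -natr1; lra.
    rewrite !natrM; have : m.+2%:R != 0 :> R by rewrite pnatr_eq0.
    move: (m.+2%:R) => r r0; field; rewrite r0; lra.
  apply: ereal_sup_ubound; exists (scalar_lens d.+1./2 0); first by exists 0.
  by exists (scalar_lens d.+1./2 m); first by exists m.
Qed.
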